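(* Let $q=0$, let $B$ be a real positive definite $M\times M$ matrix, let $\nu$ be the distribution of the eigenvalues of $B$ with respect to the normalized trace $\mathrm{tr}_M$ (that is, $\nu$ assigns mass $1/M$ to each of the eigenvalues of $B$, counted with multiplicity), and let $\lambda=M/N$. If $\mathbf W\in\mathcal W_q(I_N,B)$ with $q=0$, then $\frac1N\mathbf W$ has the compound Marchenko-Pastur law $\pi_{\nu,\lambda}$ with respect to the state $\tau\circ\mathrm{tr}_N$. In particular, if $\mathbf W\in\mathcal W_q(I_N,I_M)$ with $q=0$, then $\frac1N\mathbf W$ has the Marchenko-Pastur law with parameter $\lambda$ with respect to $\tau\circ\mathrm{tr}_N$.
   Context: A noncommutative probability space is a unital complex $*$-algebra $\mathcal A$ with a tracial state $\tau$. For $q=0$: elements $\mathbf X_1,\mathbf X_2,\dots\in\mathcal A$ are (jointly) $q$-Gaussian if $\mathbf X_j=\mathbf X_j^*$ and for any $\mathbf Y_1,\dots,\mathbf Y_n\in\{\mathbf X_1,\mathbf X_2,\dots\}$, $\tau(\mathbf Y_1\cdots\mathbf Y_n)=\sum_{\mathcal V}\prod_{\{i,j\}\in\mathcal V,\,i<j}\tau(\mathbf Y_i\mathbf Y_j)$, the sum over all non-crossing pair partitions $\mathcal V$ of $\{1,\dots,n\}$ (zero for odd $n$); for general $q$ the sum is over all pair partitions weighted by $q^{\text{number of crossings}}$. $\mathbf W\in\mathcal W_q(\Sigma,B)$ means $\mathbf W=\mathbf X^*\mathbf X$, i.e. $[\mathbf W]_{i,j}=\sum_k\mathbf X_{k,i}\mathbf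 X_{k,j}$, where $\mathbf X=[\mathbf X_{i,j}]$ is an $M\times N$ matrix of jointly $q$-Gaussian elements with $\tau(\mathbf X_{i,j}\mathbf X_{k,m})=[B]_{i,k}[\Sigma]_{j,m}$. On $N\times N$ matrices over $\mathcal A$, $\tau\circ\mathrm{tr}_N(\mathbf Z)=\frac1N\sum_{i=1}^N\tau([\mathbf Z]_{i,i})$. A self-adjoint $\mathbf Z$ has law $\mu$ with respect to $\tau\circ\mathrm{tr}_N$ if $\tau\circ\mathrm{tr}_N(\mathbf Z^n)=\int x^n\,\mu(dx)$ for all $n\ge1$. The free cumulants $\{r_k\}_{k\ge1}$ of a probability measure $\mu$ with all moments are defined by $\int x^n\mu(dx)=\sum_{\mathcal V\in NC[1,\dots,n]}\prod_{V\in\mathcal V}r_{\#V}$ for all $n\ge 1$, where $NC[1,\dots,n]$ is the set of non-crossing partitions of $(1,\dots,n)$. The Marchenko-Pastur law with parameter $\lambda>0$ is $$\pi_\lambda(dx)=(1-\lambda)^+\delta_0+\frac{\sqrt{4\lambda-(x-1-\lambda)^2}}{2\pi x}1_{(1-\sqrt\lambda)^2\le x\le(1+\sqrt\lambda)^2}\,dx.$$ The compound Marchenko-Pastur law $\pi_{\nu,\lambda}$ is the law with free cumulants $r_k=\lambda\int x^k\,\nu(dx)$, $k\ge1$; equivalently its $n$-th moment is $\sum_{\mathcal V\in NC[1,\dots,n]}\lambda^{\#\mathcal V}\prod_{V\in\mathcal V}\int x^{\#V}\nu(dx)$. *)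

(* Defs.v *)
From HB Require Import structures.
From mathcomp Require Import all_boot all_order all_algebra.
From mathcomp Require Import all_classical all_reals all_analysis.
From mathcomp Require Import measurable_realfun complex.
Set Implicit Arguments.
Unset Strict Implicit.
Unset Printing Implicit Defensive.
Import Order.TTheory GRing.Theory Num.Theory.
Import numFieldNormedType.Exports.
Local Open Scope ring_scope.
Local Open Scope complex_scope.

(* The trace property is part of the structure; faithfulness of [tau] is not
   assumed. *)
Record ncProbSpace (R : realType) := NCProbSpace {
  nc_alg :> algType R[i];
  star : nc_alg -> nc_alg;
  tau : {scalar nc_alg};
  starK : forall x, star (star x) = x;
  starD : forall x y, star (x + y) = star x + star y;
  starZ : forall (c : R[i]) x, star (c *: x) = conjc c *: star x;
  starM : forall x y, star (x * y) = star y * star x;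
  tau1 : tau 1 = 1;
  tau_ge0 : forall x, 0 <= tau (star x * x);
  tauC : forall x y, tau (x * y) = tau (y * x)
}.
Arguments star {R n} x : rename.
Arguments tau {R n} : rename.

Section Partitions.
Variable n : nat.
Implicit Types (U : {set 'I_n}) (V : {set {set 'I_n}}).

Definition crosses U U' : bool :=
  [exists a in U, exists b in U', exists c in U, exists d in U',
    [&& (a < b)%N, (b < c)%N & (c < d)%N]].

Definition noncrossing V : bool :=
  [forall U in V, forall U' in V, (U != U') ==> ~~ crosses U U'].

Definition nc_partition V : bool :=
  finset.partition V [set: 'I_n] && noncrossing V.

Definition pair_partition V : bool :=
  finset.partition V [set: 'I_n] && [forall U in V, #|U| == 2].

(* For two disjoint pairs that cross, exactly one of [crosses U U'] and
   [crosses U' U] holds, so every crossing is counted once. *)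
Definition crossings V : nat :=
  #|[set p : {set 'I_n} * {set 'I_n} |
      [&& p.1 \in V, p.2 \in V & crosses p.1 p.2]]|.

End Partitions.

(* At [q = 0] the weight [q ^+ crossings V] selects the non-crossing pair
   partitions. *)
Lemma crossings0 (n : nat) (V : {set {set 'I_n}}) :
  pair_partition V -> (crossings V == 0)%N = noncrossing V.
Proof.
move=> /andP[_ /forall_inP V2]; rewrite /crossings cards_eq0.
apply/eqP/forall_inP => [V0 U UV|ncV].
  apply/forall_inP => U' U'V; apply/implyP => _; apply/negP => cr.
  have : (U, U') \in (finset.set0 : {set {set 'I_n} * {set 'I_n}}).
    by rewrite -V0 inE /= UV U'V.
  by rewrite inE.
apply/eqP/finset.set0Pn => -[[U U']]; rewrite inE /= => /and3P[UV U'V cr].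
have [UU'|] := eqVneq U U'; last first.
  by move=> UU'; have /forall_inP/(_ _ U'V)/implyP/(_ UU')/negP := ncV _ UV; exact.
move: cr; rewrite -{}UU' => /exists_inP[a aU] /exists_inP[b bU].
move=> /exists_inP[c cU] /exists_inP[d dU] /and3P[ab bc cd].
have := V2 _ UV; apply/negP; rewrite neq_ltn; apply/orP; right.
have : [set a; b; c] \subset U.
  by apply/fintype.subsetP => x; rewrite !inE => /orP[/orP[]|] /eqP->.
move=> /subset_leq_card; apply: leq_trans.
rewrite finset.setUC cardsU1 cards2 !inE.
have ac : (a < c)%N by exact: ltn_trans ab bc.
by rewrite -!val_eqE /= (gtn_eqF ac) (gtn_eqF bc) (ltn_eqF ab).
Qed.

Definition qGaussian (R : realType) (A : ncProbSpace R) (q : R) (I : Type)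
    (X : I -> A) : Prop :=
  (forall i, star (X i) = X i) /\
  forall (n : nat) (w : 'I_n -> I),
    tau (\prod_(k < n) X (w k)) =
      \sum_(V : {set {set 'I_n}} | pair_partition V)
        (q ^+ crossings V)%:C *
        \prod_(p : 'I_n * 'I_n | (p.1 < p.2)%N && ([set p.1; p.2] \in V))
          tau (X (w p.1) * X (w p.2)).

Definition adjmx (R : realType) (A : ncProbSpace R) (m n : nat)
    (X : 'M[A]_(m, n)) : 'M[A]_(n, m) := map_mx star X^T.

Definition qWishart (R : realType) (A : ncProbSpace R) (q : R) (M N : nat)
    (S : 'M[R]_N) (B : 'M[R]_M) (W : 'M[A]_N) : Prop :=
  exists X : 'M[A]_(M, N),
    [/\ qGaussian q (fun ij : 'I_M * 'I_N => X ij.1 ij.2),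
        forall i j k m, tau (X i j * X k m) = (B i k * S j m)%:C
      & W = adjmx X *m X].

Definition tau_tr (R : realType) (A : ncProbSpace R) (N : nat)
    (Z : 'M[A]_N) : R[i] := N%:R^-1 * \sum_(i < N) tau (Z i i).

Definition scalemx_nc (R : realType) (A : ncProbSpace R) (m n : nat)
    (c : R) (Z : 'M[A]_(m, n)) : 'M[A]_(m, n) :=
  map_mx (fun a : A => c%:C *: a) Z.

Section Laws.
Variable R : realType.
Local Notation measR := {measure set (measurableTypeR R) -> \bar R}.

(* Order 0 is left out here and in [has_moments]: it is automatic for a
   probability measure. *)
Definition all_moments (mu : measR) : Prop :=
  forall n : nat, (1 <= n)%N ->
    mu.-integrable [set: R]%classic (fun x : R => (x ^+ n)%:E).

Definition moment (mu : measR) (n : nat) : R := \int[mu]_x (x ^+ n).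

Definition has_moments (A : ncProbSpace R) (N : nat) (Z : 'M[A]_N)
    (m : nat -> R) : Prop :=
  adjmx Z = Z /\
  forall n : nat, (1 <= n)%N -> tau_tr (Z ^+ n) = (m n)%:C.

Definition has_law (A : ncProbSpace R) (N : nat) (Z : 'M[A]_N)
    (mu : measR) : Prop :=
  all_moments mu /\ has_moments Z (moment mu).

Definition nc_cumulant_sum (r : nat -> R) (n : nat) : R :=
  \sum_(V : {set {set 'I_n}} | nc_partition V) \prod_(U in V) r #|U|.

Definition free_cumulants (mu : measR) (r : nat -> R) : Prop :=
  all_moments mu /\
  forall n : nat, (1 <= n)%N -> moment mu n = nc_cumulant_sum r n.

Definition compound_MP_cumulant (nu : measR) (lam : R) (k : nat) : R :=
  lam * moment nu k.

Definition is_compound_MP (nu : measR) (lam : R)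
    (mu : probability (measurableTypeR R) R) : Prop :=
  free_cumulants mu (compound_MP_cumulant nu lam).

Definition compound_MP_moment (nu : measR) (lam : R) (n : nat) : R :=
  \sum_(V : {set {set 'I_n}} | nc_partition V)
    lam ^+ #|V| * \prod_(U in V) moment nu #|U|.

End Laws.

Lemma compound_MP_momentE (R : realType)
    (nu : {measure set (measurableTypeR R) -> \bar R}) (lam : R) (n : nat) :
  nc_cumulant_sum (compound_MP_cumulant nu lam) n =
  compound_MP_moment nu lam n.
Proof.
apply: eq_bigr => V _; rewrite /compound_MP_cumulant big_split /=.
by rewrite prodr_const.
Qed.

Definition posdefmx (R : realType) (n : nat) (B : 'M[R]_n) : Prop :=
  B^T = B /\ forall v : 'cV[R]_n, v != 0 -> 0 < (v^T *m B *m v) 0 0.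

(* The roots of the characteristic polynomial over the complex numbers, with
   multiplicity; they are real when [B] is symmetric ([char_poly_eigenvalues]),
   in which case taking real parts only changes their type. *)
Definition eigenvalues (R : realType) (n : nat) (B : 'M[R]_n) : seq R :=
  [seq complex.Re z |
    z <- sval (closed_field_poly_normal
                 (char_poly (map_mx (fun x : R => x%:C) B)))].

Definition spectral_distribution (R : realType) (M : nat) (B : 'M[R]_M) :
    {measure set (measurableTypeR R) -> \bar R} :=
  mscale (M%:R^-1 : R)%:nng
    (msum (fun k => \d_((eigenvalues B)`_k : measurableTypeR R)) M).

Lemma char_poly_complex_roots (R : realType) (n : nat) (B : 'M[R]_n) :
  let BC := map_mx (fun x : R => x%:C) B in
  char_poly BC =
  \prod_(z <- sval (closed_field_poly_normal (char_poly BC))) ('X - z%:P).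
Proof.
move=> BC; case: closed_field_poly_normal => s /= {1}->.
by rewrite (monicP (char_poly_monic _)) scale1r.
Qed.

Lemma sym_eigenvalue_real (R : realType) (n : nat) (B : 'M[R]_n) (z : R[i]) :
  B^T = B -> root (char_poly (map_mx (fun x : R => x%:C) B)) z ->
  z = (complex.Re z)%:C.
Proof.
move=> Bsym; rewrite -eigenvalue_root_char => /eigenvalueP[v vB v0].
set BC := map_mx _ B in vB.
pose w := (map_mx conjc v)^T.
have cK : map_mx conjc w^T = v.
  by rewrite /w trmxK; apply/matrixP => i j; rewrite !mxE conjcK.
have BCc : (map_mx conjc BC)^T = BC.
  have Bij i j : B j i = B i j by rewrite -{1}Bsym mxE.
  by apply/matrixP => i j; rewrite !mxE /= oppr0 Bij.
have sE : v *m BC *m w = z *: (v *m w) by rewrite vB scalemxAl.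
have conjT (m p q : nat) (X : 'M[R[i]]_(m, p)) (Y : 'M[R[i]]_(p, q)) :
    (map_mx conjc (X *m Y))^T = (map_mx conjc Y)^T *m (map_mx conjc X)^T.
  by rewrite map_mxM trmx_mul.
have wE : (map_mx conjc w)^T = v by rewrite map_trmx cK.
have vwE : (map_mx conjc (v *m w))^T = v *m w by rewrite conjT wE.
have := congr1 (fun X : 'M[R[i]]_1 => (map_mx conjc X)^T) sE.
rewrite /= conjT conjT BCc wE mulmxA map_mxZ linearZ /= vwE -/w sE => /eqP.
rewrite -subr_eq0 -scalerBl scaler_eq0 => /orP[|/eqP vw0].
  rewrite subr_eq0; case: z {vB sE} => a b /eqP[] /= /eqP.
  by rewrite -addr_eq0 -mulr2n mulrn_eq0 /= => /eqP ->.
case/negP: v0; apply/eqP/matrixP => i j; rewrite ord1 mxE.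
have := congr1 (fun X : 'M[R[i]]_1 => X 0 0) vw0.
rewrite !mxE => /psumr_eq0P.
have pos k : true -> 0 <= v 0 k * w k 0 by move=> _; rewrite !mxE; exact: mul_conjC_ge0.
by move=> /(_ (fun k _ => pos k isT) j isT)/eqP; rewrite !mxE mulf_eq0 conjc_eq0 orbb => /eqP.
Qed.

Lemma char_poly_eigenvalues (R : realType) (n : nat) (B : 'M[R]_n) :
  B^T = B -> char_poly B = \prod_(a <- eigenvalues B) ('X - a%:P).
Proof.
move=> Bsym; apply: (map_poly_inj (real_complex R)).
rewrite map_char_poly char_poly_complex_roots rmorph_prod big_map.
rewrite big_seq [RHS]big_seq; apply: eq_bigr => z zs.
rewrite rmorphB /= map_polyX map_polyC /=; congr ('X - _%:P).
apply: (sym_eigenvalue_real Bsym).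
by rewrite char_poly_complex_roots root_prod_XsubC.
Qed.

Lemma size_eigenvalues (R : realType) (n : nat) (B : 'M[R]_n) :
  size (eigenvalues B) = n.
Proof.
rewrite size_map; apply: succn_inj.
by rewrite -(size_char_poly (map_mx (fun x : R => x%:C) B))
  [in RHS]char_poly_complex_roots size_prod_XsubC.
Qed.

Section MarchenkoPastur.
Variable R : realType.
Variable lam : R.

Definition MP_density (x : R) : R :=
  if (1 - Num.sqrt lam) ^+ 2 <= x <= (1 + Num.sqrt lam) ^+ 2 then
    Num.sqrt (4 * lam - (x - 1 - lam) ^+ 2) / (2 * pi * x)
  else 0.

Lemma MP_density_ge0 x : 0 <= MP_density x.
Proof.
rewrite /MP_density; case: ifP => // /andP[x1 _].
have x0 : 0 <= x by exact: le_trans (sqr_ge0 _) x1.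
by rewrite divr_ge0 ?sqrtr_ge0 ?mulr_ge0 ?pi_ge0.
Qed.

Lemma measurable_MP_density :
  measurable_fun [set: measurableTypeR R]%classic MP_density.
Proof.
have -> : MP_density = fun x =>
    if (1 - Num.sqrt lam) ^+ 2 <= x <= (1 + Num.sqrt lam) ^+ 2 then
      Num.sqrt (4 * lam - (x - 1 - lam) ^+ 2) * ((2 * pi)^-1 * x `^ (-1))
    else 0.
  apply/funext => x; rewrite /MP_density; case: ifP => // /andP[x1 _].
  by rewrite powR_inv1 ?(le_trans (sqr_ge0 _) x1)// invfM.
apply: measurable_fun_ifT => //.
  by apply: measurable_and; apply: measurable_fun_ler.
apply: measurable_funM.
  apply: (@measurableT_comp _ _ _ _ _ _ (@Num.sqrt R)).
    by apply: continuous_measurable_fun; exact: sqrt_continuous.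
  by apply: measurable_funB => //; apply: measurable_funX;
    do 2 apply: measurable_funB => //.
by apply: measurable_funM => //; exact: measurable_powR.
Qed.

Definition MP_ac (V : set (measurableTypeR R)) : \bar R :=
  (\int[lebesgue_measure]_(x in V) (MP_density x)%:E)%E.

Let MP_ac0 : MP_ac set0 = 0%E.
Proof. by rewrite /MP_ac integral_set0. Qed.

Let MP_ac_ge0 V : (0 <= MP_ac V)%E.
Proof. by apply: integral_ge0 => x _; rewrite lee_fin MP_density_ge0. Qed.

Let MP_ac_sigma_additive : semi_sigma_additive MP_ac.
Proof.
move=> /= F mF tF mUF; rewrite /MP_ac; apply: cvg_toP.
  apply: ereal_nondecreasing_is_cvgn => m n mn.
  apply: lee_sum_nneg_natr => // k _ _; apply: integral_ge0 => /= x Fkx.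
  by rewrite lee_fin MP_density_ge0.
rewrite ge0_integral_bigcup//=.
- by apply: measurable_funTS; apply/measurable_EFinP; exact: measurable_MP_density.
- by move=> x _; rewrite lee_fin MP_density_ge0.
Qed.

HB.instance Definition _ := isMeasure.Build _ _ _
  MP_ac MP_ac0 MP_ac_ge0 MP_ac_sigma_additive.

Lemma MP_atom_ge0 : 0 <= Num.max (1 - lam) 0.
Proof. by rewrite le_max lexx orbT. Qed.

Definition marchenko_pastur : {measure set (measurableTypeR R) -> \bar R} :=
  measure_add (mscale (NngNum MP_atom_ge0) (\d_(0 : measurableTypeR R))) MP_ac.

End MarchenkoPastur.

(* Main.v *)
Require Import Defs.
From mathcomp Require Import all_boot all_order all_algebra.
From mathcomp Require Import all_classical all_reals all_analysis.
From mathcomp Require Import measurable_realfun complex.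
From mathcomp Require Import zify ring lra.
Import Order.TTheory GRing.Theory Num.Theory.
Import numFieldNormedType.Exports.
Local Open Scope ring_scope.

(** The moments of a free Wishart matrix and the free cumulant sums of the
    compound Marchenko-Pastur law are shown to be determined by the same
    recursion, which is the coefficientwise form of the functional equation
    [t(z) = 1 + sum_k r_k (z t(z))^k].

    On the matrix side, the trace of the [n]-th power of [W = X^T * X] expands
    into Gaussian words read along closed paths ([pathsum]). The non-crossing
    Wick formula contracts the first letter of a word with a later one and leaves
    two independent words ([tau_wick]); together with the covariance, which is
    [B] on row indices and the identity on column indices, this expresses the
    moment matrices [T] of [X^T * X] and [G] of [X * X^T] through each other
    ([wishart_mxS], [dual_wishart_mxS]):
      [T_(m+1) = sum_t tr (B G_t) T_(m-t)],
      [G_(m+1) = sum_t tr (T_t) B G_(m-t)].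
    Solving the second equation for [G] yields a geometric series in [B], which
    is how the traces of the powers of [B], that is, the moments of its spectral
    distribution, become the free cumulants.

    On the combinatorial side, a non-crossing partition is decomposed according
    to the element that follows the first one in its block ([NCsum_rec]). The
    weights of blocks being arbitrary functions, the same recursion serves twice:
    for weights carried by pairs it is the Wick contraction, and for weights
    depending on cardinalities it is the recursion of free cumulant sums
    ([NCsum_shifted]). In the latter a block is consumed one element at a time,
    which matches the expansion of [G] one factor [B] at a time
    ([wishart_shifted_rec]), and avoids solving for [G] altogether.

    When [B = 1] the recursion is quadratic in the moments, so that their
    generating series is algebraic of degree two and hence satisfies a linear
    differential equation ([quadratic_linear_rec]). The integrals of the
    Marchenko-Pastur density, computed in the angular variable of its support,
    obey the same linear recurrence by integration by parts ([trig_moment_rec]),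
    with the same initial value. *)

Set Implicit Arguments.
Unset Strict Implicit.
Unset Printing Implicit Defensive.

(** * Sums over non-crossing partitions *)

(* Inside this module the names of the finite set theory take precedence over
   their homonyms for classical sets. *)
Module NonCrossing.
Import mathcomp.boot.fintype mathcomp.boot.finset.

Section NCsum.
Variables (K : comNzRingType) (n : nat).
Implicit Types (D U : {set 'I_n}) (V : {set {set 'I_n}}).
Implicit Types (w : {set 'I_n} -> K) (a j x y : 'I_n) (b : nat).

Definition nc_on D V := finset.partition V D && noncrossing V.

Lemma nc_onP D V : reflect
  [/\ set0 \notin V, forall U, U \in V -> U \subset D,
      forall x, x \in D -> exists2 U, U \in V & x \in U,
      forall U U' x, U \in V -> U' \in V -> x \in U -> x \in U' -> U = U'
    & forall U U' x y z t, U \in V -> U' \in V -> x \in U -> y \in U' ->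
        z \in U -> t \in U' -> (x < y < z)%N -> (z < t)%N -> U = U']
  (nc_on D V).
Proof.
apply: (iffP andP) => [[pV /forall_inP nV]|[V0 VD DV tV nV]].
  split.
  - by case/and3P: pV.
  - by move=> U; apply: partitionS.
  - move=> x xD; exists (pblock V x); last by rewrite mem_pblock (cover_partition pV).
    by rewrite pblock_mem ?(cover_partition pV).
  - move=> U U' x UV U'V xU xU'; have tV := partition_trivIset pV.
    by rewrite -(def_pblock tV UV xU) (def_pblock tV U'V xU').
  - move=> U U' x y z t UV U'V xU yU' zU tU' /andP[xy yz] zt.
    apply/eqP/negPn/negP => UU'.
    have /forall_inP/(_ _ U'V)/implyP/(_ UU')/negP := nV _ UV; apply.
    apply/exists_inP; exists x => //; apply/exists_inP; exists y => //.
    apply/exists_inP; exists z => //; apply/exists_inP; exists t => //.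
    by apply/and3P.
split; last first.
  apply/forall_inP => U UV; apply/forall_inP => U' U'V; apply/implyP => UU'.
  apply/negP => /exists_inP[x xU] /exists_inP[y yU] /exists_inP[z zU].
  move=> /exists_inP[t tU] /and3P[xy yz zt].
  by move/eqP: UU'; apply; apply: (nV U U' x y z t); rewrite // xy.
apply/and3P; split => //.
  apply/eqP/setP => x; apply/bigcupP/idP => [[U UV]|/DV[U UV xU]].
    exact/subsetP/VD.
  by exists U.
apply/trivIsetP => U U' UV U'V UU'; rewrite -setI_eq0; apply/eqP/setP => x.
rewrite !inE; apply/negP => /andP[xU xU'].
by move/eqP: UU'; apply; apply: tV xU xU'.
Qed.

(** The weight depends on the block itself, and not only on its cardinality, so
    that both the pairings of Gaussian words and the free cumulant sums are
    instances, and so that a block can be truncated while its weight remembers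
    what was removed ([shift_weight]). *)
Definition NCsum w D : K := \sum_(V | nc_on D V) \prod_(U in V) w U.

Definition ord_itv (a b : nat) : {set 'I_n} := [set k : 'I_n | (a <= k < b)%N].

Lemma NCsum_set0 w : NCsum w set0 = 1.
Proof.
rewrite /NCsum (big_pred1 set0) ?big_set0// => V; rewrite /nc_on partition_set0.
rewrite /=; case: eqP => // ->; apply/forall_inP => U; by rewrite inE.
Qed.

Lemma ord_itv_nil (a b : nat) : (b <= a)%N -> ord_itv a b = set0.
Proof. by move=> ba; apply/setP => x; rewrite !inE; lia. Qed.

Lemma eq_NCsum w w' D : (forall U, U \subset D -> w U = w' U) ->
  NCsum w D = NCsum w' D.
Proof.
move=> ww'; apply: eq_bigr => V /nc_onP[_ VD _ _ _]; apply: eq_bigr => U UV.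
exact/ww'/VD.
Qed.

Lemma NCsum_singleton w a b : (a < b)%N ->
  \sum_(V | nc_on (ord_itv a b) V && ([set a] \in V)) \prod_(U in V) w U =
  w [set a] * NCsum w (ord_itv a.+1 b).
Proof.
move=> ab; rewrite /NCsum big_distrr /=.
rewrite (reindex_onto (fun V => [set a] |: V) (fun V => V :\ [set a])) /=; last first.
  by move=> V /andP[_ aV]; rewrite finset.setD1K.
have aI V : nc_on (ord_itv a.+1 b) V -> forall U, U \in V -> a \notin U.
  move=> /nc_onP[_ VD _ _ _] U UV; apply/negP => aU.
  by have /subsetP/(_ _ aU) := VD _ UV; rewrite inE ltnn.
have aV V : nc_on (ord_itv a.+1 b) V -> [set a] \notin V.
  by move=> /aI h; apply/negP => /h; rewrite inE eqxx.
apply: eq_big => V; last first.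
  move=> /andP[_ /eqP VE]; rewrite big_setU1//.
  by rewrite -VE !inE eqxx.
apply/idP/idP; last first.
  move=> ncV; have := aI _ ncV; have := aV _ ncV => {aI aV} aV aI.
  rewrite setU11 andbT [in X in _ && X]setU1K// eqxx andbT.
  have /nc_onP[V0 VD DV tV nV] := ncV.
  apply/nc_onP; split.
  - rewrite !inE (negbTE V0) orbF; apply/negP => /eqP/setP/(_ a).
    by rewrite !inE eqxx.
  - move=> U; rewrite !inE => /orP[/eqP ->|/VD UD].
      by rewrite sub1set inE leqnn.
    apply: fintype.subset_trans UD _; apply/subsetP => x; rewrite !inE; lia.
  - move=> x; rewrite inE => /andP[ax xb].
    have [<-|xa] := eqVneq a x; first by exists [set a]; rewrite ?setU11 ?inE.
    have /DV[U UV xU] : x \in ord_itv a.+1 b.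
      by rewrite inE; move: xa; rewrite -val_eqE /=; lia.
    by exists U => //; rewrite inE UV orbT.
  - move=> U U' x; rewrite !inE => /orP[/eqP->|UV] /orP[/eqP->|U'V] //.
    + by rewrite inE => /eqP-> /(negP (aI _ U'V)).
    + by move=> /[swap]; rewrite inE => /eqP-> /(negP (aI _ UV)).
    + exact: tV.
  - move=> U U' x y z t; rewrite !inE => /orP[/eqP->|UV] /orP[/eqP->|U'V] //.
    + by rewrite !inE => /eqP -> _ /eqP ->; lia.
    + by rewrite !inE => _ /eqP -> _ /eqP ->; lia.
    + exact: nV.
rewrite setU11 andbT => /andP[/nc_onP[V0 VD DV tV nV] /eqP VE].
have aV' : [set a] \notin V by rewrite -VE !inE eqxx.
have sV U : U \in V -> U \in [set a] |: V by rewrite inE => ->; rewrite orbT.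
have aU U : U \in V -> a \notin U.
  move=> UV; apply/negP => aU; move: aV'.
  by rewrite (tV [set a] U a) ?setU11 ?set11 ?sV// UV.
apply/nc_onP; split.
- by apply: contra V0; exact: sV.
- move=> U UV; apply/subsetP => x xU.
  have /subsetP/(_ _ xU) := VD _ (sV _ UV); rewrite !inE => /andP[ax ->].
  rewrite ltn_neqAle ax !andbT; apply/eqP => /val_inj xa.
  by move: (aU _ UV); rewrite xa xU.
- move=> x; rewrite inE => /andP[ax xb].
  have /DV[U] : x \in ord_itv a b by rewrite inE xb (ltnW ax).
  rewrite !inE => /orP[/eqP->|]; last by exists U.
  by rewrite inE => /eqP xa; rewrite xa ltnn in ax.
- by move=> U U' x /sV UV /sV U'V; exact: tV.
- by move=> U U' x y z t /sV UV /sV U'V; exact: nV.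
Qed.

Definition next_in V a j :=
  [exists U in V, [&& a \in U, j \in U & U :&: ord_itv a.+1 j == set0]].

(** The weight to use once [a] has been deleted from the block that contains its
    successor [j]. *)
Definition shift_weight w a j U := if j \in U then w (a |: U) else w U.

Lemma next_inP V a j : reflect (exists U, [/\ U \in V, a \in U, j \in U &
    forall x, x \in U -> (a < x)%N -> (j <= x)%N]) (next_in V a j).
Proof.
apply: (iffP exists_inP) => [[U UV /and3P[aU jU /eqP UE]]|[U [UV aU jU h]]].
  exists U; split => // x xU ax; move/setP: UE => /(_ x).
  by rewrite !inE xU ax /=; lia.
exists U => //; rewrite aU jU /=; apply/eqP/setP => x; rewrite !inE.
by case xU: (x \in U) => //=; case ax : (a < x)%N => //=; have := h _ xU ax; lia.
Qed.

Section Merge.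
Variables (a j : 'I_n) (b : nat).
Hypotheses (aj : (a < j)%N) (jb : (j < b)%N).

(* A partition in which [j] follows [a] is cut into the blocks strictly between
   [a] and [j] and the other ones, from which [a] is deleted; conversely [a] is
   put back into the block of [j]. *)
Let ext U := if j \in U then a |: U else U.
Let merge (p : {set {set 'I_n}} * {set {set 'I_n}}) := p.1 :|: ext @: p.2.
Let inner V := [set U in V | U \subset ord_itv a.+1 j].
Let outer V := [set U in V | ~~ (U \subset ord_itv a.+1 j)].
Let unmerge V := (inner V, (fun U => U :\ a) @: outer V).

Section Unmerge.
Variable V : {set {set 'I_n}}.
Hypotheses (ncV : nc_on (ord_itv a b) V) (aVj : next_in V a j).

(** A block with elements on both sides of [j] would cross the block of [a] and
    [j]: this is where non-crossing makes the partition split. *)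
Lemma block_cases U : U \in V ->
  [\/ a \in U /\ j \in U, a \notin U /\ U \subset ord_itv a.+1 j |
      [/\ a \notin U, j \notin U & U \subset ord_itv j b]].
Proof.
move: ncV aVj => /nc_onP[V0 VD DV tV nV] /next_inP[U0 [U0V aU0 jU0 U0h]] UV.
have [aU|aU] := boolP (a \in U).
  by apply: Or31; rewrite (tV U U0 a).
have jU : j \notin U.
  by apply/negP => jU; move: aU; rewrite (tV U U0 j) ?aU0.
have ltax x : x \in U -> (a < x < b)%N.
  move=> xU; have /subsetP/(_ _ xU) := VD _ UV; rewrite inE => /andP[ax ->].
  rewrite andbT ltn_neqAle ax andbT; apply/eqP => /val_inj xa.
  by move: aU; rewrite xa xU.
have [UI|/subsetPn[y yU yI]] := boolP (U \subset ord_itv a.+1 j).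
  by apply: Or32.
apply: Or33; split => //; apply/subsetP => x xU; rewrite inE.
have /andP[ax ->] := ltax _ xU; rewrite andbT leqNgt; apply/negP => xj.
have yj : (j < y)%N.
  have /andP[ay yb] := ltax _ yU; move: yI; rewrite inE ay /= -leqNgt.
  rewrite leq_eqVlt => /orP[/eqP/val_inj jy|//].
  by move: jU; rewrite jy yU.
move: aU; rewrite -(nV U0 U a x j y) ?aU0 ?ax ?xj //.
Qed.

Lemma outer_sub U : U \in V -> ~~ (U \subset ord_itv a.+1 j) -> U :\ a \subset ord_itv j b.
Proof.
move=> UV; case: (block_cases UV) => [[aU jU] _|[_ ->]//|[aU jU UI] _].
  move: ncV aVj => /nc_onP[V0 VD DV tV nV] /next_inP[U0 [U0V aU0 jU0 U0h]].
  apply/subsetP => x; rewrite !inE => /andP[xa xU].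
  have /subsetP/(_ _ xU) := VD _ UV; rewrite inE => /andP[ax ->]; rewrite andbT.
  apply: U0h; first by rewrite -(tV U U0 a).
  rewrite ltn_neqAle ax andbT; apply/eqP => /val_inj xa'.
  by rewrite xa' eqxx in xa.
by apply: fintype.subset_trans UI; exact: subsetDl.
Qed.

Lemma unmergeK : merge (unmerge V) = V.
Proof.
have extK U : U \in outer V -> ext (U :\ a) = U.
  rewrite inE => /andP[UV nU]; rewrite /ext.
  have ja : (j == a) = false by rewrite -val_eqE /=; lia.
  rewrite !inE ja /=; case: (block_cases UV) => [[aU jU]|[_]|[aU jU _]].
  - by rewrite jU setD1K.
  - by rewrite (negbTE nU).
  - rewrite (negbTE jU); apply/setDidPl; rewrite disjoint_sym.
    by rewrite disjoints1.
rewrite /merge /= -imset_comp.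
rewrite (eq_in_imset (g := id)); last by move=> U UV /=; rewrite extK.
rewrite imset_id; apply/setP => U; rewrite !inE.
by rewrite -andb_orr orbN andbT.
Qed.

Lemma unmerge_nc : nc_on (ord_itv a.+1 j) (unmerge V).1 && nc_on (ord_itv j b) (unmerge V).2.
Proof.
have oS := outer_sub; have bC := block_cases.
move: ncV aVj => /nc_onP[V0 VD DV tV nV] /next_inP[U0 [U0V aU0 jU0 U0h]].
apply/andP; split; apply/nc_onP; split => /=.
- by rewrite !inE (negbTE V0).
- by move=> U; rewrite inE => /andP[].
- move=> x; rewrite inE => /andP[ax xj].
  have /DV[U UV xU] : x \in ord_itv a b by rewrite inE; lia.
  exists U => //; rewrite inE UV /=.
  case: (bC _ UV) => [[aU jU]|[]//|[_ _ /subsetP/(_ _ xU)]].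
    have := U0h x; rewrite (tV U0 U a)// => /(_ xU ax).
    by rewrite leqNgt xj.
  by rewrite inE leqNgt xj.
- move=> U U' x; rewrite !inE => /andP[UV _] /andP[U'V _]; exact: tV.
- move=> U U' x y z t; rewrite !inE => /andP[UV _] /andP[U'V _]; exact: nV.
- apply/imsetP => -[U]; rewrite inE => /andP[UV nU] /eqP.
  rewrite eq_sym setD_eq0 finset.subset1 => /orP[/eqP Ua|/eqP U0'].
    case: (bC _ UV) => [[_]|[]|[]]; rewrite ?Ua ?inE ?eqxx//.
    by rewrite -val_eqE /= gtn_eqF.
  by move: V0; rewrite -U0' UV.
- by move=> _ /imsetP[U + ->]; rewrite inE => /andP[UV nU]; exact: oS.
- move=> x; rewrite inE => /andP[jx xb].
  have ax : (a < x)%N by exact: leq_trans aj jx.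
  have /DV[U UV xU] : x \in ord_itv a b by rewrite inE xb ltnW.
  exists (U :\ a); last by rewrite !inE xU andbT -val_eqE /= gtn_eqF.
  apply/imsetP; exists U => //; rewrite inE UV /=; apply/subsetPn.
  by exists x => //; rewrite inE (leqNgt x.+1) ltnS jx andbF.
- move=> _ _ x /imsetP[U + ->] /imsetP[U' + ->]; rewrite !inE.
  move=> /andP[UV _] /andP[U'V _] /andP[_ xU] /andP[_ xU'].
  by rewrite (tV U U' x).
- move=> _ _ x y z t /imsetP[U + ->] /imsetP[U' + ->]; rewrite !inE.
  move=> /andP[UV _] /andP[U'V _] /andP[_ xU] /andP[_ yU] /andP[_ zU] /andP[_ tU].
  by move=> xyz zt; rewrite (nV U U' x y z t).
Qed.
End Unmerge.

Section MergeFacts.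
Variables V1 V2 : {set {set 'I_n}}.
Hypotheses (nc1 : nc_on (ord_itv a.+1 j) V1) (nc2 : nc_on (ord_itv j b) V2).

Lemma notin_right_block U : U \in V2 -> a \notin U.
Proof.
move=> UV; apply/negP => aU; have /nc_onP[_ VD _ _ _] := nc2.
have /subsetP/(_ _ aU) := VD _ UV; rewrite inE; lia.
Qed.

Lemma in_ext U x : U \in V2 -> (x \in ext U) = (x \in U) || (x == a) && (j \in U).
Proof.
move=> UV; rewrite /ext; case: ifP => jU; rewrite ?inE ?andbT ?andbF ?orbF//.
by rewrite orbC.
Qed.

Lemma in_ext_neq U x : U \in V2 -> x \in ext U -> x != a -> x \in U.
Proof. by move=> /in_ext-> /orP[//|/andP[-> //]]. Qed.

Lemma ext_notsub U : U \in V2 -> ~~ (ext U \subset ord_itv a.+1 j).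
Proof.
move=> UV; apply/subsetPn; have /nc_onP[V0 VD _ _ _] := nc2.
have /set0Pn[x xU] : U != set0 by apply: contraNneq V0 => <-.
exists x; first by rewrite in_ext// xU.
have /subsetP/(_ _ xU) := VD _ UV; rewrite !inE; lia.
Qed.

Lemma extK U : U \in V2 -> ext U :\ a = U.
Proof.
move=> UV; apply/setP => x; rewrite in_setD1 in_ext//.
case: (eqVneq x a) => [->|] /=; last by rewrite orbF.
by rewrite (negbTE (notin_right_block UV)).
Qed.

Lemma merge_inner : inner (merge (V1, V2)) = V1.
Proof.
apply/setP => U; rewrite !inE; apply/andP/idP => [[/orP[//|]]|UV].
  by case/imsetP => U' U'V -> h; move: (ext_notsub U'V); rewrite h.
by have /nc_onP[_ VD _ _ _] := nc1; rewrite UV VD.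
Qed.

Lemma merge_outer : outer (merge (V1, V2)) = ext @: V2.
Proof.
apply/setP => U; rewrite !inE; apply/andP/idP => [[/orP[|//]]|].
  by have /nc_onP[_ VD _ _ _] := nc1; move=> /VD ->.
by move=> /[dup] UV /imsetP[U' U'V ->]; rewrite ext_notsub// imset_f// orbT.
Qed.

Lemma mergeK : unmerge (merge (V1, V2)) = (V1, V2).
Proof.
rewrite /unmerge merge_inner merge_outer -imset_comp; congr (_, _).
rewrite (eq_in_imset (g := id)) ?imset_id// => U UV /=; exact: extK.
Qed.

Lemma ext_inj : {in V2 &, injective ext}.
Proof. by move=> U U' UV U'V e; rewrite -(extK UV) e extK. Qed.

Lemma ext_notin U : U \in V2 -> ext U \notin V1.
Proof.
move=> UV; apply/negP; have /nc_onP[_ VD _ _ _] := nc1; move=> /VD.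
exact/negP/ext_notsub.
Qed.

Lemma merge_weight w : \prod_(U in merge (V1, V2)) w U =
  (\prod_(U in V1) w U) * \prod_(U in V2) shift_weight w a j U.
Proof.
rewrite /merge /= (eq_bigl [in [predU V1 & ext @: V2]]); last by move=> U; rewrite !inE.
rewrite bigU /=; last first.
  rewrite -setI_eq0; apply/eqP/setP => U; rewrite !inE; apply/negP => /andP[UV].
  by case/imsetP => U' U'V UE; move: (ext_notin U'V); rewrite -UE UV.
congr (_ * _); rewrite big_imset /=; last exact: ext_inj.
by apply: eq_bigr => U UV; rewrite /shift_weight /ext; case: ifP.
Qed.

(** Gluing creates no crossing: [a] can only be the first of the four points of
    a crossing, and it can then be replaced by [j]. *)
Lemma merge_nc : nc_on (ord_itv a b) (merge (V1, V2)) && next_in (merge (V1, V2)) a j.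
Proof.
have /nc_onP[V10 V1D DV1 tV1 nV1] := nc1.
have /nc_onP[V20 V2D DV2 tV2 nV2] := nc2.
have in1 U x : U \in V1 -> x \in U -> (a < x < j)%N.
  by move=> UV xU; have /subsetP/(_ _ xU) := V1D _ UV; rewrite inE.
have in2 U x : U \in V2 -> x \in U -> (j <= x < b)%N.
  by move=> UV xU; have /subsetP/(_ _ xU) := V2D _ UV; rewrite inE.
have in2' U x : U \in V2 -> x \in ext U -> (x = a :> nat) \/ (j <= x < b)%N.
  by move=> UV; rewrite in_ext// => /orP[/(in2 _ _ UV)|/andP[/eqP->]]; [right|left].
apply/andP; split; last first.
  have /DV2[U UV jU] : j \in ord_itv j b by rewrite inE leqnn jb.
  apply/next_inP; exists (ext U); split.
  - by rewrite inE imset_f ?orbT.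
  - by rewrite in_ext// eqxx jU orbT.
  - by rewrite in_ext// jU.
  - by move=> x /(in2' _ _ UV); clear; lia.
apply/nc_onP; split.
- rewrite !inE negb_or V10; apply/imsetP => -[U UV] /esym U0.
  by move: (ext_notsub UV); rewrite U0 sub0set.
- move=> U; rewrite inE => /orP[UV|/imsetP[U' UV ->]]; apply/subsetP => x xU.
    by move: (in1 _ _ UV xU) jb; rewrite inE; clear; lia.
  by move: (in2' _ _ UV xU) aj jb; rewrite inE; clear; lia.
- move=> x; rewrite inE => /andP[ax xb].
  have [xa|xa] := eqVneq a x.
    have /DV2[U UV jU] : j \in ord_itv j b by rewrite inE leqnn jb.
    by exists (ext U); rewrite ?inE ?imset_f ?orbT// in_ext// -xa eqxx jU orbT.
  have ax' : (a < x)%N by move: xa; rewrite ltn_neqAle ax andbT -val_eqE.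
  have [xj|jx] := ltnP x j.
    have /DV1[U UV xU] : x \in ord_itv a.+1 j by rewrite inE ax'.
    by exists U; rewrite // inE UV.
  have /DV2[U UV xU] : x \in ord_itv j b by rewrite inE jx.
  by exists (ext U); rewrite ?inE ?imset_f ?orbT// in_ext// xU.
- move=> U U' x; rewrite !inE => /orP[UV|/imsetP[U1 UV ->]];
    move=> /orP[U'V|/imsetP[U1' U'V ->]] xU xU'.
  + exact: tV1 xU xU'.
  + by move: (in1 _ _ UV xU) (in2' _ _ U'V xU'); clear; lia.
  + by move: (in1 _ _ U'V xU') (in2' _ _ UV xU); clear; lia.
  + congr ext; move: xU xU'; rewrite !in_ext//.
    have [->|xa] := eqVneq x a; last by rewrite !orbF; exact: tV2.
    by rewrite (negbTE (notin_right_block UV)) (negbTE (notin_right_block U'V)) /=; exact: tV2.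
- move=> U U' x y z t; rewrite !inE => /orP[UV|/imsetP[U1 UV ->]];
    move=> /orP[U'V|/imsetP[U1' U'V ->]] xU yU' zU tU' xyz zt.
  + exact: nV1 xU yU' zU tU' xyz zt.
  + move: (in1 _ _ UV xU) (in1 _ _ UV zU) (in2' _ _ U'V yU') xyz.
    by clear; lia.
  + move: (in1 _ _ U'V yU') (in1 _ _ U'V tU') (in2' _ _ UV zU) xyz zt.
    by clear; lia.
  + congr ext.
    have /and3P[ay az at_] : [&& a < y, a < z & a < t]%N.
      by move: (in2' _ _ UV xU) xyz zt aj; clear; lia.
    have gtaE (k : 'I_n) : (a < k)%N -> k != a by move=> ak; rewrite -val_eqE /= gtn_eqF.
    have yU1 : y \in U1' by apply: in_ext_neq yU' _ => //; exact: gtaE.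
    have zU1 : z \in U1 by apply: in_ext_neq zU _ => //; exact: gtaE.
    have tU1 : t \in U1' by apply: in_ext_neq tU' _ => //; exact: gtaE.
    move: xU; rewrite in_ext// => /orP[xU|/andP[/eqP xa jU]].
      exact: (nV2 U1 U1' x y z t).
    have [yj|yj] := eqVneq y j; first by apply: (tV2 U1 U1' j); rewrite // -yj.
    apply: (nV2 U1 U1' j y z t) => //; have /andP[jy _] := in2 _ _ U'V yU1.
    have /andP[_ yz] := xyz; rewrite yz andbT ltn_neqAle jy andbT.
    by move: yj; rewrite eq_sym -val_eqE.
Qed.

End MergeFacts.

Lemma NCsum_merge w :
  \sum_(V | nc_on (ord_itv a b) V && next_in V a j) \prod_(U in V) w U =
  NCsum w (ord_itv a.+1 j) * NCsum (shift_weight w a j) (ord_itv j b).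
Proof.
rewrite /NCsum big_distrlr /= pair_big /=.
rewrite (reindex_onto merge unmerge) /=; last first.
  by move=> V /andP[ncV aVj]; exact: unmergeK.
apply: eq_big => -[V1 V2] /=; last first.
  move=> /andP[/andP[ncV aVj] /eqP VE]; have := unmerge_nc ncV aVj.
  by rewrite VE => /andP[nc1 nc2]; exact: merge_weight.
apply/idP/idP => [/andP[/andP[ncV aVj] /eqP VE]|/andP[nc1 nc2]].
  by have := unmerge_nc ncV aVj; rewrite VE.
by rewrite merge_nc// mergeK//=.
Qed.

End Merge.

(** The one-step recursion to which all the combinatorics reduces: either [a] is
    alone in its block, or it has a successor [j] there, and then the elements
    between [a] and [j] and those from [j] on are partitioned independently. *)
Lemma NCsum_rec w a b : (a < b)%N ->
  NCsum w (ord_itv a b) = w [set a] * NCsum w (ord_itv a.+1 b) +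
    \sum_(j : 'I_n | (a < j < b)%N)
      NCsum w (ord_itv a.+1 j) * NCsum (shift_weight w a j) (ord_itv j b).
Proof.
move=> ab; rewrite -NCsum_singleton// {1}/NCsum (bigID (fun V => [set a] \in V)) /=.
congr (_ + _).
transitivity (\sum_(j : 'I_n | (a < j < b)%N)
    \sum_(V | nc_on (ord_itv a b) V && next_in V a j) \prod_(U in V) w U); last first.
  by apply: eq_bigr => j /andP[aj jb]; exact: NCsum_merge.
rewrite (exchange_big_dep (fun V => nc_on (ord_itv a b) V)) /=; last first.
  by move=> j V _ /andP[].
rewrite [RHS](bigID (fun V => [set a] \in V)) /= [X in _ = X + _]big1 ?add0r; last first.
  move=> V /andP[/nc_onP[V0 VD DV tV nV] aV]; apply: big_pred0 => j.
  apply/negP => /and3P[/andP[aj jb] ncV /next_inP[U [UV aU jU h]]].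
  move: jU; rewrite (tV U [set a] a)// ?inE// => /eqP ja.
  by move: aj; rewrite ja ltnn.
apply: eq_bigr => V /andP[ncV aV]; have /nc_onP[V0 VD DV tV nV] := ncV.
have /DV[U UV aU] : a \in ord_itv a b by rewrite inE leqnn ab.
have /set0Pn[j0] : U :\ a != set0.
  rewrite setD_eq0 finset.subset1 negb_or; apply/andP; split.
    by apply: contraNneq aV => <-.
  by apply: contraNneq V0 => <-.
rewrite !inE => /andP[j0a j0U].
(* the successor of [a] is the least other element of its block *)
have [j] : exists2 j, (j \in U) && (a < j)%N & forall x, (x \in U) && (a < x)%N -> (j <= x)%N.
  have Pj0 : (j0 \in U) && (a < j0)%N.
    rewrite j0U /=; have /subsetP/(_ _ j0U) := VD _ UV; rewrite inE => /andP[aj _].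
    by move: j0a; rewrite ltn_neqAle aj andbT eq_sym -val_eqE.
  case: (@arg_minnP _ j0 (fun x : 'I_n => (x \in U) && (a < x)%N) val Pj0) => j Pj h.
  by exists j.
move=> /andP[jU aj] h.
rewrite (big_pred1 j) // => i; rewrite ncV /=; apply/andP/eqP.
  move=> [/andP[ai ib] /next_inP[U' [U'V aU' iU' h']]]; apply/val_inj/eqP => /=.
  have UE : U' = U by apply: (tV U' U a).
  by rewrite eqn_leq h' ?UE//= h// -UE iU'.
move=> ->; split; last by apply/next_inP; exists U; split => // x xU ax; rewrite h ?xU.
by rewrite aj; have /subsetP/(_ _ jU) := VD _ UV; rewrite inE => /andP[].
Qed.

End NCsum.

Section Weights.
Variable K : comNzRingType.

Lemma big_ord_itv n (a b : nat) (G : nat -> K) : (b <= n)%N ->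
  \sum_(j < n | (a < j < b)%N) G j = \sum_(i < b - a.+1) G (a.+1 + i)%N.
Proof.
move=> bn; rewrite -(big_mkord (fun j => a < j < b)%N G).
transitivity (\sum_(a.+1 <= j < b) G j); last first.
  by rewrite -{1}[a.+1]add0n big_addn big_mkord; apply: eq_bigr => i _; rewrite addnC.
rewrite [RHS](big_nat_widenl _ 0%N)// [RHS](big_nat_widen _ _ _ _ _ bn).
by apply: eq_bigl => j.
Qed.

Section Size.
Variables (r : nat -> K) (n : nat) (c : nat -> K) (F : nat -> nat -> K).
Hypotheses (c0 : c 0 = 1) (cF : forall m, c m.+1 = F 0 m.+1).
Hypothesis (FE : forall k m, F k m.+1 =
  r k.+1 * c m + \sum_(i < m) c i * F k.+1 (m - i)).

Let shifted (x : 'I_n) k (U : {set 'I_n}) :=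
  if x \in U then r (#|U| + k) else r #|U|.

(** [F k m] stands for the sum over the partitions of [m] points in which the
    block of the first point counts as if it had [k] further elements; deleting
    the first point of that block increases [k] by one, and this is what makes
    the system of recursions closed. *)
Lemma NCsum_shifted m : forall x : 'I_n, (x + m <= n)%N ->
  (forall k, (0 < m)%N -> NCsum (shifted x k) (ord_itv _ x (x + m)) = F k m) /\
  NCsum (fun U : {set 'I_n} => r #|U|) (ord_itv _ x (x + m)) = c m.
Proof.
elim/ltn_ind: m => m IH x xm.
suff H : forall k, (0 < m)%N -> NCsum (shifted x k) (ord_itv _ x (x + m)) = F k m.
  split=> //; case: m {IH} xm H => [|m] xm H.
    by rewrite ord_itv_nil ?addn0// NCsum_set0 c0.
  rewrite cF -H//; apply: eq_NCsum => U _; rewrite /shifted addn0.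
  by case: ifP.
move=> k m0; case: m m0 IH xm => // m _ IH xm.
have IHc a l : (l <= m)%N -> (a + l <= n)%N ->
    NCsum (fun U : {set 'I_n} => r #|U|) (ord_itv _ a (a + l)) = c l.
  case: l => [|l] lm al; first by rewrite ord_itv_nil ?addn0// NCsum_set0 c0.
  have an : (a < n)%N by lia.
  by have [//|_] := IH l.+1 lm (Ordinal an).
have tail a b : (x < a)%N -> NCsum (shifted x k) (ord_itv _ a b) =
    NCsum (fun U : {set 'I_n} => r #|U|) (ord_itv _ a b).
  move=> xa; apply: eq_NCsum => U UI; rewrite /shifted; case: ifP => // xU.
  by have /subsetP/(_ _ xU) := UI; rewrite inE leqNgt xa.
rewrite NCsum_rec ?addnS ?ltnS ?leq_addr// FE {1}/shifted set11 cards1 add1n.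
rewrite tail// -addSn IHc ?addSn -?addnS//; congr (_ + _).
transitivity (\sum_(j < n | (x < j < x + m.+1)%N)
    c (j - x.+1)%N * F k.+1 (m - (j - x.+1))%N).
  apply: eq_bigr => j /andP[xj jm]; rewrite tail//; congr (_ * _).
    rewrite -{1}(subnKC xj) IHc ?subnKC//; last exact: ltnW.
    by move: jm; clear; lia.
  have jE : (x + m.+1 = j + (m - (j - x.+1)))%N by move: jm xj; clear; lia.
  rewrite {1}jE; have [||] := IH (m - (j - x.+1))%N _ j.
  - by move: jm xj; clear; lia.
  - by rewrite -jE.
  move=> /(_ k.+1) + _ => <-; last by move: jm xj; clear; lia.
  apply: eq_NCsum => U UI; rewrite /shift_weight /shifted.
  have xU : x \notin U.
    by apply/negP => xU; have /subsetP/(_ _ xU) := UI; rewrite inE leqNgt xj.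
  case: ifP => jU; last by rewrite (negbTE xU).
  by rewrite setU11 cardsU1 xU add1n addSnnS.
rewrite (big_ord_itv x (fun j => c (j - x.+1)%N * F k.+1 (m - (j - x.+1))%N))//.
have -> : (x + m.+1 - x.+1 = m)%N by lia.
by apply: eq_bigr => i _; rewrite addKn.
Qed.

Lemma NCsum_size : NCsum (fun U : {set 'I_n} => r #|U|) [set: 'I_n] = c n.
Proof.
have -> : [set: 'I_n] = ord_itv n 0 n by apply/setP => x; rewrite !inE ltn_ord.
case: (posnP n) => [n0|n0]; first by rewrite ord_itv_nil ?n0// NCsum_set0 c0.
by have [|_] := @NCsum_shifted n (Ordinal n0).
Qed.
End Size.

(** ** Wick words *)

Section Wick.
Variables (I : Type) (c : I -> I -> K).

(** The first letter is contracted with a later one, which isolates the word in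
    between from the word after. As these are not subterms of the word, the
    recursion is driven by a bound [k] on the length, which [wick] instantiates
    and [wick_rec_size] makes irrelevant. *)
Fixpoint wick_rec k (s : seq I) : K :=
  if k is k'.+1 then
    if s is x :: s' then
      \sum_(j < size s') c x (nth x s' j) *
        (wick_rec k' (take j s') * wick_rec k' (drop j.+1 s'))
    else 1
  else 1.

Definition wick s := wick_rec (size s) s.

Lemma wick_nil : wick [::] = 1. Proof. by []. Qed.

Lemma wick_rec_size k s : (size s <= k)%N -> wick_rec k s = wick s.
Proof.
rewrite /wick; move: {2}k (leqnn k) => l; elim: l k s => [|l IH] [|k] [|x s] //=.
rewrite !ltnS => kl sk; apply: eq_bigr => j _.
have js := ltn_ord j.
have ht : (size (take j s) <= size s)%N by rewrite size_take js ltnW.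
have hd : (size (drop j.+1 s) <= size s)%N by rewrite size_drop leq_subr.
by rewrite !IH// ?(IH (size s)) ?(leq_trans sk kl)// ?(leq_trans _ sk).
Qed.

Lemma wick_cons x s : wick (x :: s) =
  \sum_(j < size s) c x (nth x s j) * (wick (take j s) * wick (drop j.+1 s)).
Proof.
rewrite {1}/wick /=; apply: eq_bigr => j _; have js := ltn_ord j.
by rewrite !wick_rec_size// ?size_drop ?leq_subr// size_take js ltnW.
Qed.

Lemma NCsum_eq0 n (w : {set 'I_n} -> K) (D : {set 'I_n}) x : x \in D ->
  (forall U : {set 'I_n}, U \subset D -> x \in U -> w U = 0) -> NCsum w D = 0.
Proof.
move=> xD w0; apply: big1 => V /nc_onP[_ VD /(_ _ xD)[U UV xU] _ _].
by rewrite (bigD1 U)//= w0 ?mul0r// VD.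
Qed.

Section Pairs.
Variables (n : nat) (f : 'I_n -> I).

Definition pair_weight (U : {set 'I_n}) : K :=
  if #|U| == 2 then
    \prod_(p : 'I_n * 'I_n | (p.1 < p.2)%N && ([set p.1; p.2] == U))
      c (f p.1) (f p.2)
  else 0.

Lemma pair_weight_card (U : {set 'I_n}) : #|U| != 2 -> pair_weight U = 0.
Proof. by rewrite /pair_weight => /negbTE ->. Qed.

Lemma pair_weightE (a j : 'I_n) : (a < j)%N ->
  pair_weight [set a; j] = c (f a) (f j).
Proof.
move=> aj; have aj' : a != j by rewrite -val_eqE /= ltn_eqF.
rewrite /pair_weight cards2 aj' /= (big_pred1 (a, j))//= => -[x y] /=.
apply/andP/eqP => [[xy /eqP/setP e]|[-> ->]]; last by rewrite eqxx.
have := e a; have := e j; rewrite !inE !eqxx orbT /= => /orP[/eqP jx|/eqP <-].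
  move=> /orP[/eqP ax|/eqP ay]; first by move: aj'; rewrite ax jx eqxx.
  by move: xy aj; rewrite jx ay; lia.
by move=> /orP[/eqP ->//|/eqP ay]; rewrite ay eqxx in aj'.
Qed.

(** Only blocks with two elements have a nonzero weight, so that the block of [a]
    is complete as soon as the successor of [a] is known. *)
Lemma NCsum_pair_rec (a : 'I_n) b : (a < b)%N -> (b <= n)%N ->
  NCsum pair_weight (ord_itv n a b) =
  \sum_(j < n | (a < j < b)%N) c (f a) (f j) *
    (NCsum pair_weight (ord_itv n a.+1 j) * NCsum pair_weight (ord_itv n j.+1 b)).
Proof.
move=> ab bn; rewrite NCsum_rec// pair_weight_card ?cards1// mul0r add0r.
apply: eq_bigr => j /andP[aj jb]; rewrite [RHS]mulrCA; congr (_ * _).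
rewrite NCsum_rec// [X in _ + X]big1 ?addr0.
  rewrite {1}/shift_weight set11 pair_weightE//; congr (_ * _).
  apply: eq_NCsum => U UI; rewrite /shift_weight; case: ifP => // jU.
  by have /subsetP/(_ _ jU) := UI; rewrite inE ltnn.
move=> k /andP[jk kb]; rewrite [X in _ * X](@NCsum_eq0 _ _ _ k) ?mulr0//.
  by rewrite inE leqnn.
move=> U UI kU; rewrite /shift_weight kU setU11 pair_weight_card//.
have lowU (x : 'I_n) : (x < k)%N -> x \notin U.
  move=> xk; apply/negP => xU; have /subsetP/(_ _ xU) := UI.
  by rewrite inE leqNgt xk.
rewrite cardsU1 !inE negb_or -val_eqE /= (ltn_eqF aj) lowU ?(ltn_trans aj jk)//=.
by rewrite cardsU1 lowU// (cardsD1 k) kU.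
Qed.

End Pairs.

(** The statement is proved for all the intervals of positions of [s] at once;
    an interval is compared with the subword that it carries, which avoids
    transporting partitions between ordinal types of different sizes. *)
Lemma NCsum_wick x0 (s : seq I) :
  NCsum (pair_weight (fun k : 'I_(size s) => nth x0 s k)) [set: 'I_(size s)] =
  wick s.
Proof.
pose sl a b := drop a (take b s).
set pw := pair_weight _.
suff H m a b : (b - a <= m)%N -> (b <= size s)%N -> NCsum pw (ord_itv _ a b) = wick (sl a b).
  have -> : [set: 'I_(size s)] = ord_itv _ 0 (size s).
    by apply/setP => x; rewrite !inE ltn_ord.
  by rewrite (H (size s)) ?subn0// /sl drop0 take_size.
elim: m a b => [|m IH] a b bam bs.
  have ba : (b <= a)%N by move: bam; clear; lia.
  by rewrite ord_itv_nil// NCsum_set0 /sl drop_oversize// size_takel.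
have [ba|ab] := leqP b a.
  by rewrite ord_itv_nil// NCsum_set0 /sl drop_oversize// size_takel.
have an : (a < size s)%N by lia.
rewrite (@NCsum_pair_rec _ _ (Ordinal an))//=.
have slE : sl a b = nth x0 s a :: sl a.+1 b.
  by rewrite /sl (drop_nth x0) ?size_takel// nth_take.
have sz : size (sl a.+1 b) = (b - a.+1)%N.
  by rewrite /sl size_drop size_takel.
pose G j := c (nth x0 s a) (nth (nth x0 s a) (sl a.+1 b) (j - a.+1)) *
   (wick (take (j - a.+1) (sl a.+1 b)) *
    wick (drop (j - a.+1).+1 (sl a.+1 b))).
transitivity (\sum_(j < size s | (a < j < b)%N) G j); last first.
  rewrite (big_ord_itv a G bs) slE wick_cons sz.
  by apply: eq_bigr => i _; rewrite /G addKn.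
apply: eq_bigr => j /andP[aj jb]; rewrite /G.
have jE : (j = a.+1 + (j - a.+1) :> nat)%N by rewrite subnKC.
rewrite !IH; try by move: aj jb bam bs; clear; lia.
rewrite /sl nth_drop drop_drop take_drop -jE subnK// take_takel; last exact: ltnW.
rewrite nth_take// addSn addnC -jE.
by rewrite (set_nth_default x0 (nth x0 s a))// (leq_trans jb).
Qed.

End Wick.
End Weights.

Section TauWick.
Variables (R : realType) (A : ncProbSpace R) (I : Type) (X : I -> A).
Variable c : I -> I -> R.
Hypothesis cE : forall i j, tau (X i * X j) = (c i j)%:C%C.

(** At [q = 0] the weight of a pairing vanishes unless the pairing is
    non-crossing, and a free Gaussian word is then evaluated by contractions. *)
Lemma tau_wick s : qGaussian 0 X -> tau (\prod_(x <- s) X x) = (wick c s)%:C%C.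
Proof.
move=> [_ gX]; case: s => [|x0 s']; first by rewrite big_nil tau1.
set s := x0 :: s'; rewrite (big_nth x0) big_mkord.
rewrite (gX _ (fun k => nth x0 s k)) -(NCsum_wick c x0) /NCsum.
rewrite (bigID (fun V => noncrossing V)) /= [X in _ + X]big1 ?addr0; last first.
  move=> V /andP[pV]; rewrite -crossings0// => /negbTE V0.
  by rewrite expr0n V0 mul0r.
rewrite rmorph_sum /=.
rewrite [RHS](bigID (fun V : {set {set 'I_(size s)}} => [forall U in V, #|U| == 2])) /=.
rewrite [X in _ = _ + X]big1 ?addr0; last first.
  move=> V /andP[_ /forall_inPn[U UV U2]].
  by rewrite (bigD1 U)//= pair_weight_card// mul0r.
apply: eq_big => V.
  by rewrite /pair_partition /nc_on andbAC.
move=> /andP[pV ncV]; have /eqP V0 : crossings V == 0%N by rewrite crossings0.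
rewrite V0 expr0 mul1r rmorph_prod /=.
move: pV => /andP[_ /forall_inP V2].
rewrite (partition_big (fun p => [set p.1; p.2]) (mem V)) /=; last first.
  by move=> p /andP[].
apply: eq_bigr => U UV; rewrite /pair_weight V2// rmorph_prod.
apply: eq_big => [p|p /andP[_ _]]; last by rewrite cE.
by case: eqP => [->|]; rewrite ?andbF// UV !andbT.
Qed.
End TauWick.
End NonCrossing.
Import NonCrossing.

(** * Words along the entries of matrix powers *)

Section PathSum.
Variable I : Type.

(** Applied to the product of letters, this is the entry [(i, u)] of the [m]-th
    power of [L^T * L]: the words are those read along the paths of [2 * m] steps
    from [i] to [u] in the complete bipartite graph on [I1] and [I2]. *)
Fixpoint pathsum (Z : zmodType) (I1 I2 : finType) (L : I1 -> I2 -> I) m i u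
    (f : seq I -> Z) : Z :=
  if m is m'.+1 then
    \sum_k \sum_j pathsum L m' j u (fun w => f [:: L k i, L k j & w])
  else f [::] *+ (i == u).

Lemma eq_pathsum (Z : zmodType) (I1 I2 : finType) (L : I1 -> I2 -> I) m i u (f g : seq I -> Z) :
  (forall w, size w = m.*2 -> f w = g w) -> pathsum L m i u f = pathsum L m i u g.
Proof.
elim: m i f g => [|m IH] i f g fg /=; first by rewrite fg.
apply: eq_bigr => k _; apply: eq_bigr => j _; apply: IH => w sw.
by rewrite fg //= sw.
Qed.

Lemma pathsum_raddf (Z Z' : zmodType) (I1 I2 : finType) (L : I1 -> I2 -> I) m i u
    (phi : {additive Z -> Z'}) (f : seq I -> Z) :
  phi (pathsum L m i u f) = pathsum L m i u (phi \o f).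
Proof.
elim: m i f => [|m IH] i f /=; first by rewrite raddfMn.
rewrite raddf_sum; apply: eq_bigr => k _; rewrite raddf_sum.
by apply: eq_bigr => j _; rewrite IH.
Qed.

Lemma pathsumMl (Z : pzRingType) (I1 I2 : finType) (L : I1 -> I2 -> I) m i u
    (a : Z) (f : seq I -> Z) :
  a * pathsum L m i u f = pathsum L m i u (fun w => a * f w).
Proof.
elim: m i f => [|m IH] i f /=; first by rewrite mulrnAr.
rewrite mulr_sumr; apply: eq_bigr => k _; rewrite mulr_sumr.
by apply: eq_bigr => j _; rewrite IH.
Qed.

Lemma pathsumMr (Z : pzRingType) (I1 I2 : finType) (L : I1 -> I2 -> I) m i u
    (a : Z) (f : seq I -> Z) :
  pathsum L m i u f * a = pathsum L m i u (fun w => f w * a).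
Proof.
elim: m i f => [|m IH] i f /=; first by rewrite mulrnAl.
rewrite mulr_suml; apply: eq_bigr => k _; rewrite mulr_suml.
by apply: eq_bigr => j _; rewrite IH.
Qed.

Lemma pathsum_sum (Z : zmodType) (I1 I2 : finType) (L : I1 -> I2 -> I) m i u
    n (f : 'I_n -> seq I -> Z) :
  pathsum L m i u (fun w => \sum_t f t w) = \sum_t pathsum L m i u (f t).
Proof.
elim: m i f => [|m IH] i f /=; first by rewrite sumrMnl.
rewrite [RHS]exchange_big; apply: eq_bigr => k _.
by rewrite [RHS]exchange_big; apply: eq_bigr => j _; rewrite IH.
Qed.

(** Cutting a path of odd length at an even position: the first part is a path
    sum for the transposed array of letters. *)
Lemma pathsum_split (Z : zmodType) (I1 I2 : finType) (L : I1 -> I2 -> I)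
    t m k u (f : seq I -> Z) :
  \sum_j pathsum L (t + m) j u (fun w => f (L k j :: w)) =
  \sum_l \sum_j pathsum (fun i k => L k i) t k l (fun w1 =>
    pathsum L m j u (fun w2 => f (w1 ++ L l j :: w2))).
Proof.
elim: t k f => [|t IH] k f /=.
  rewrite [RHS](bigD1 k)//= eqxx [X in _ = _ + X]big1 ?addr0.
    by apply: eq_bigr => j _; rewrite mulr1n.
  by move=> l lk; rewrite big1// => j _; rewrite eq_sym (negbTE lk).
under eq_bigr do under eq_bigr do rewrite (IH _ (fun w => f [:: _, _ & w])).
under [RHS]eq_bigr do rewrite exchange_big.
rewrite [RHS]exchange_big; apply: eq_bigr => j _ /=.
under [RHS]eq_bigr do rewrite exchange_big.
rewrite [RHS]exchange_big; apply: eq_bigr => k' _ /=.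
by apply: eq_bigr => l _; apply: eq_bigr => j' _.
Qed.

Section PathWick.
Variables (K : comNzRingType) (c : I -> I -> K).

Lemma wick_odd s : odd (size s) -> wick c s = 0.
Proof.
move: {2}(size s) (leqnn (size s)) => n; elim: n s => [|n IH] [|x s]//=.
rewrite ltnS => sn es; rewrite wick_cons big1// => j _; have js := ltn_ord j.
have [jo|je] := boolP (odd j).
  have -> : wick c (take j s) = 0; last by rewrite mul0r mulr0.
  by apply: IH; rewrite size_takel ?(ltnW js)// (leq_trans (ltnW js)).
have -> : wick c (drop j.+1 s) = 0; last by rewrite !mulr0.
apply: IH; rewrite size_drop ?(leq_trans (leq_subr _ _))//.
by rewrite oddB//= (negbTE je) (negbTE es).
Qed.

(** Words of odd length vanish, so that the letter contracted with the first one
    leaves an even number of letters on either side. *)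
Lemma wick_cons_odd x s m : size s = m.*2.+1 -> wick c (x :: s) =
  \sum_(t < m.+1) c x (nth x s t.*2) *
    (wick c (take t.*2 s) * wick c (drop t.*2.+1 s)).
Proof.
move=> sm; rewrite wick_cons sm.
pose G j := c x (nth x s j) * (wick c (take j s) * wick c (drop j.+1 s)).
rewrite -(big_mkord xpredT G) -[RHS](big_mkord xpredT (G \o double)).
have G0 t : (t < m)%N -> G t.*2.+1 = 0.
  move=> tm; rewrite /G [wick c (take _ _)]wick_odd ?mul0r ?mulr0// size_takel ?oddS ?odd_double//.
  by rewrite sm ltnS leq_double ltnW.
elim: m {sm} G0 => [|m IH] G0; first by rewrite !big_nat1.
rewrite doubleS !(big_nat_recr m.*2.+2)//= !(big_nat_recr m.*2.+1)//= (big_nat_recr m.+1)//=.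
by rewrite IH ?G0 ?addr0// => t tm; rewrite G0// ltnW.
Qed.

(** Contracting the first letter turns the moments of [L^T * L] into convolutions
    of the moments of [L * L^T] and of [L^T * L] of lower order. *)
Lemma pathsum_wickS (I1 I2 : finType) (L : I1 -> I2 -> I) m i u :
  pathsum L m.+1 i u (wick c) =
  \sum_(t < m.+1) \sum_k \sum_l \sum_j c (L k i) (L l j) *
    (pathsum (fun i k => L k i) t k l (wick c) * pathsum L (m - t) j u (wick c)).
Proof.
rewrite /= [RHS]exchange_big; apply: eq_bigr => k _ /=.
pose f t v := c (L k i) (nth (L k i) v t.*2) *
   (wick c (take t.*2 v) * wick c (drop t.*2.+1 v)).
transitivity (\sum_j \sum_(t < m.+1) pathsum L m j u (fun w => f t (L k j :: w))).
  apply: eq_bigr => j _; rewrite -pathsum_sum; apply: eq_pathsum => w sw.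
  by rewrite (wick_cons_odd _ (m := m))//= sw.
rewrite exchange_big; apply: eq_bigr => t _ /=.
have := pathsum_split L t (m - t) k u (f t).
rewrite subnKC; last by rewrite -ltnS.
move=> ->.
apply: eq_bigr => l _; apply: eq_bigr => j _.
transitivity (pathsum (fun i k => L k i) t k l (fun w1 =>
    c (L k i) (L l j) * (wick c w1 * pathsum L (m - t) j u (wick c)))).
  apply: eq_pathsum => w1 sw1.
  rewrite mulrA pathsumMl.
  apply: eq_pathsum => w2 _; rewrite /f /=.
  rewrite -sw1 take_size_cat// nth_cat ltnn subnn /= mulrA.
  by rewrite -cat_rcons drop_size_cat// size_rcons.
by rewrite -pathsumMl -pathsumMr.
Qed.

End PathWick.
End PathSum.

(** * Moments of Wishart matrices *)

Section Recursion.
Variables (R : comNzRingType) (M N : nat) (B : 'M[R]_M).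

Definition wishart_cov (p q : 'I_M * 'I_N) : R :=
  B p.1 q.1 * (1%:M : 'M[R]_N) p.2 q.2.

(** The entrywise states of the powers of [X^T * X], see [tau_wishart_exp], and,
    for [dual_wishart_mx], of those of [X * X^T]. *)
Definition wishart_mx m : 'M[R]_N :=
  \matrix_(i, u) pathsum (fun (k : 'I_M) (i : 'I_N) => (k, i)) m i u
    (wick wishart_cov).

Definition dual_wishart_mx m : 'M[R]_M :=
  \matrix_(k, l) pathsum (fun (i : 'I_N) (k : 'I_M) => (k, i)) m k l
    (wick wishart_cov).

Local Notation T := wishart_mx.
Local Notation G := dual_wishart_mx.

Lemma wishart_mx0 : T 0 = 1%:M.
Proof. by apply/matrixP => i u; rewrite !mxE /= wick_nil. Qed.

Lemma dual_wishart_mx0 : G 0 = 1%:M.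
Proof. by apply/matrixP => i u; rewrite !mxE /= wick_nil. Qed.

Lemma wishart_mxS m :
  T m.+1 = \sum_(t < m.+1) \tr (B^T *m G t) *: T (m - t).
Proof.
apply/matrixP => i u; rewrite mxE pathsum_wickS summxE; apply: eq_bigr => t _.
rewrite mxE /mxtrace mulr_suml exchange_big /=; apply: eq_bigr => l _.
rewrite mxE mulr_suml; apply: eq_bigr => k _.
rewrite (bigD1 i)//= [X in _ + X]big1 ?addr0.
  by rewrite /wishart_cov !mxE /= eqxx mulr1 mulrA.
by move=> j ji; rewrite /wishart_cov /= mxE eq_sym (negbTE ji) mulr0 mul0r.
Qed.

Lemma dual_wishart_mxS m :
  G m.+1 = \sum_(t < m.+1) \tr (T t) *: (B *m G (m - t)).
Proof.
apply/matrixP => k u; rewrite mxE pathsum_wickS summxE; apply: eq_bigr => t _.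
rewrite mxE /mxtrace mulr_suml; apply: eq_bigr => i _.
rewrite (bigD1 i)//= [X in _ + X]big1 ?addr0.
  rewrite [(B *m _) _ _]mxE mulr_sumr; apply: eq_bigr => l _.
  by rewrite /wishart_cov !mxE /= eqxx mulr1 mulrCA.
move=> j ji; apply: big1 => l _.
by rewrite /wishart_cov /= mxE eq_sym (negbTE ji) mulr0 mul0r.
Qed.

End Recursion.

(** Associativity of the product of power series, read off truncations to
    polynomials. *)
Lemma convolutionA (R : comNzRingType) (f g h : nat -> R) n :
  \sum_(i < n.+1) (\sum_(t < i.+1) f t * g (i - t)%N) * h (n - i)%N =
  \sum_(t < n.+1) f t * \sum_(s < (n - t).+1) g s * h (n - t - s)%N.
Proof.
pose P (u : nat -> R) := \poly_(i < n.+1) u i.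
have PE u i : (i <= n)%N -> (P u)`_i = u i by rewrite coef_poly ltnS => ->.
have PM u v i : (i <= n)%N -> (P u * P v)`_i = \sum_(t < i.+1) u t * v (i - t)%N.
  move=> ni; rewrite coefM; apply: eq_bigr => t _.
  by rewrite !PE// ?(leq_trans (leq_subr _ _))// (leq_trans _ ni)// -ltnS.
have := congr1 (fun p : {poly R} => p`_n) (mulrA (P f) (P g) (P h)).
rewrite [X in X = _ -> _]coefM [X in _ = X -> _]coefM => e.
transitivity (\sum_(j < n.+1) (P f * P g)`_j * (P h)`_(n - j)).
  by apply: eq_bigr => i _; rewrite PM ?PE ?leq_subr// -ltnS.
rewrite -e; apply: eq_bigr => i _.
by rewrite PM ?PE ?leq_subr// -ltnS.
Qed.

Section Cumulants.
Variables (R : fieldType) (M N : nat) (B : 'M[R]_M.+1).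
Hypotheses (N0 : (N%:R : R) != 0) (BT : B^T = B).
Local Notation T := (wishart_mx N B).
Local Notation G := (dual_wishart_mx N B).

(** One factor [N%:R^-1] for each of the [n] matrices, and one for the trace. *)
Definition wishart_moment n : R := N%:R^-1 ^+ n.+1 * \tr (T n).
Local Notation c := wishart_moment.

Let g k s : R := N%:R^-1 ^+ s.+1 * \tr (B ^+ k.+1 *m G s).

Definition wishart_cumulant k : R := N%:R^-1 * \tr (B ^+ k).

(** The free cumulant sum in which the first block counts [k] further elements,
    written through the moments [g] of [X * X^T] against [B ^+ k.+1]. Each step
    from one element of a block to the next contributes one more factor [B], and
    the gap between the two contributes a moment. *)
Definition shifted_moment k n : R := if n is m.+1 then \sum_(i < m.+1) g k i * c (m - i) else 0.

Local Notation F := shifted_moment.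

Lemma wishart_moment0 : c 0 = 1.
Proof. by rewrite /c wishart_mx0 mxtrace1 expr1 mulVf. Qed.

Lemma wishart_momentS n : c n.+1 = F 0 n.+1.
Proof.
rewrite /shifted_moment /c wishart_mxS raddf_sum mulr_sumr; apply: eq_bigr => i _.
rewrite /= mxtraceZ BT /g /c expr1 [RHS]mulrACA; congr (_ * _).
rewrite -exprD; congr (_ ^+ _); have := ltn_ord i; lia.
Qed.

(** The term [i = 0] of the convolution closes the first block; in the others
    the recursion for [X * X^T] exhibits the next element of that block. *)
Lemma wishart_shifted_rec k m : F k m.+1 =
  wishart_cumulant k.+1 * c m + \sum_(i < m) c i * F k.+1 (m - i).
Proof.
rewrite /shifted_moment big_ord_recl /= subn0 /g dual_wishart_mx0 mulmx1 expr1; congr (_ + _).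
case: m => [|m]; first by rewrite !big_ord0.
transitivity (\sum_(i < m.+1) (\sum_(t < i.+1) c t * g k.+1 (i - t)) * c (m - i)).
  apply: eq_bigr => i _; rewrite /bump /= add1n subSS; congr (_ * _).
  rewrite dual_wishart_mxS mulmx_sumr raddf_sum mulr_sumr; apply: eq_bigr => t _.
  rewrite -scalemxAr /= mxtraceZ mulmxA -[B ^+ k.+1 *m B]exprSr /c /g [RHS]mulrACA.
  by congr (_ * _); rewrite -exprD; congr (_ ^+ _); have := ltn_ord t; lia.
rewrite convolutionA; apply: eq_bigr => t _.
by rewrite subSn// -ltnS.
Qed.

End Cumulants.

Lemma wishart_moment_cumulants (R : realType) M N (B : 'M[R]_M.+1) (r : nat -> R) n :
  (N%:R : R) != 0 -> B^T = B ->
  (forall k, (0 < k)%N -> r k = wishart_cumulant N B k) ->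
  nc_cumulant_sum r n = wishart_moment N B n.
Proof.
move=> N0 BT rE; rewrite /nc_cumulant_sum.
apply: (@NCsum_size _ r n (wishart_moment N B) (shifted_moment N B)).
- exact: wishart_moment0.
- exact: wishart_momentS.
- by move=> k m; rewrite rE//; exact: wishart_shifted_rec.
Qed.

Section Wishart.
Variables (R : realType) (A : ncProbSpace R) (M N : nat) (B : 'M[R]_M).
Variable X : 'M[A]_(M, N).
Hypothesis gX : qGaussian 0 (fun ij : 'I_M * 'I_N => X ij.1 ij.2).
Hypothesis covX : forall i j k m,
  tau (X i j * X k m) = (B i k * (1%:M : 'M[R]_N) j m)%:C%C.

Let W : 'M[A]_N := adjmx X *m X.

Lemma wishart_expE n i u : (W ^+ n) i u =
  pathsum (fun (k : 'I_M) (i : 'I_N) => (k, i)) n i u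
    (fun w => \prod_(p <- w) X p.1 p.2).
Proof.
elim: n i => [|n IH] i /=; first by rewrite expr0 mxE big_nil.
rewrite exprS mxE exchange_big; apply: eq_bigr => j _ /=.
rewrite mxE mulr_suml; apply: eq_bigr => k _.
rewrite IH pathsumMl; apply: eq_pathsum => w _.
rewrite !big_cons /= mulrA !mxE.
by have [sX _] := gX; rewrite (sX (k, i)).
Qed.

Lemma tau_wishart_exp n i u : tau ((W ^+ n) i u) = (wishart_mx N B n i u)%:C%C.
Proof.
rewrite wishart_expE mxE !pathsum_raddf; apply: eq_pathsum => w _ /=.
exact: (tau_wick (X := fun ij : 'I_M * 'I_N => X ij.1 ij.2)).
Qed.

Lemma scale_wishart_exp (c : R) n :
  scalemx_nc c W ^+ n = map_mx (fun a : A => (c ^+ n)%:C%C *: a) (W ^+ n).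
Proof.
elim: n => [|n IH].
  by apply/matrixP => i j; rewrite !expr0 !mxE scale1r.
apply/matrixP => i j; rewrite !exprS IH !mxE scaler_sumr; apply: eq_bigr => k _.
by rewrite !mxE -scalerAr -scalerAl scalerA mulrC rmorphM.
Qed.

Lemma adjmx_wishart (c : R) : adjmx (scalemx_nc c W) = scalemx_nc c W.
Proof.
have star0 : star (0 : A) = 0.
  by have := starD (0 : A) 0; rewrite addr0 => /eqP; rewrite -subr_eq subrr eq_sym => /eqP.
have [sX _] := gX; have sX' k i : star (X k i) = X k i := sX (k, i).
apply/matrixP => i j; rewrite !mxE starZ; congr (_ *: _).
  by apply/eqP; rewrite eq_complex /= oppr0 !eqxx.
rewrite (big_morph _ (@starD _ A) star0); apply: eq_bigr => k _.
by rewrite !mxE starM starK sX'.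
Qed.

End Wishart.

Lemma wishart_has_moments (R : realType) (A : ncProbSpace R) (M N : nat)
    (B : 'M[R]_M.+1) (W : 'M[A]_N) :
  qWishart 0 1%:M B W ->
  has_moments (scalemx_nc N%:R^-1 W) (wishart_moment N B).
Proof.
move=> [X [gX covX ->]]; split=> [|n _]; first exact: adjmx_wishart.
rewrite /tau_tr scale_wishart_exp /wishart_moment exprS -mulrA rmorphM /=.
congr (_ * _); first by rewrite fmorphV rmorph_nat.
rewrite rmorphM /mxtrace rmorph_sum mulr_sumr /=; apply: eq_bigr => i _.
by rewrite mxE linearZ /= (tau_wishart_exp gX covX).
Qed.

(** * Moments of the spectral distribution *)

Lemma conjugate_exp (F : fieldType) n (P D : 'M[F]_n) k : P \in unitmx ->
  (invmx P *m D *m P) ^+ k = invmx P *m D ^+ k *m P.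
Proof.
move=> Pu; elim: k => [|k IH]; first by rewrite !expr0 mulmx1 mulVmx.
by rewrite !exprS IH -!mulmxE !mulmxA mulmxK.
Qed.

Lemma diag_mx_exp (F : pzRingType) n (d : 'rV[F]_n) k :
  diag_mx d ^+ k = diag_mx (map_mx (fun x => x ^+ k) d).
Proof.
elim: k => [|k IH].
  by apply/matrixP => i j; rewrite expr0 !mxE expr0.
by rewrite exprS IH -mulmxE mulmx_diag; congr diag_mx; apply/rowP => j; rewrite !mxE exprS.
Qed.

(** Over the complex numbers the symmetric matrix [B] is unitarily diagonalizable,
    and its diagonal form has the same characteristic polynomial as [B], hence
    the eigenvalues of [B] as entries, up to order. *)
Lemma sum_eigenvalues_exp (R : realType) (n : nat) (B : 'M[R]_n) k :
  B^T = B -> \sum_(a <- eigenvalues B) a ^+ k = \tr (B ^+ k).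
Proof.
move=> BT; pose BC := map_mx (real_complex R) B.
have /orthomx_spectralP BE : BC \is normalmx.
  apply/hermitian_normalmx/realsym_hermsym.
    apply/is_hermitianmxP; rewrite map_mx_id// expr0 scale1r.
    by apply/matrixP => i j; rewrite !mxE -[in LHS]BT mxE.
  by apply/mxOverP => i j; rewrite mxE; apply/complex_realP; exists (B i j).
set P := spectralmx BC in BE; set d := spectral_diag BC in BE.
have Pu : P \in unitmx := spectral_unit BC.
have cE : char_poly BC = char_poly (diag_mx d).
  rewrite BE /char_poly /char_poly_mx.
  have -> : 'X%:M - map_mx polyC (invmx P *m diag_mx d *m P) =
      map_mx polyC (invmx P) *m ('X%:M - map_mx polyC (diag_mx d)) *m map_mx polyC P.
    rewrite mulmxBr mulmxBl -!map_mxM; congr (_ - _).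
    by rewrite -mulmxA -scalar_mxC mulmxA -map_mxM mulVmx// map_mx1 mul1mx.
  rewrite !det_mulmx mulrC mulrA -det_mulmx -map_mxM mulmxV//.
  by rewrite map_mx1 det1 mul1r.
have pE : perm_eq [seq a%:C%C | a <- eigenvalues B] [seq d 0 i | i <- enum 'I_n].
  apply: prod_XsubC_eq; rewrite [LHS]big_map [RHS]big_map big_enum /=.
  have dE : char_poly (diag_mx d) = \prod_i ('X - (d 0 i)%:P).
    rewrite (char_poly_trig (diag_mx_is_trig d)); apply: eq_bigr => i _.
    by rewrite mxE eqxx mulr1n.
  rewrite -dE -cE; transitivity (map_poly (real_complex R) (char_poly B)).
    rewrite (char_poly_eigenvalues BT) rmorph_prod; apply: eq_bigr => a _.
    by rewrite /= rmorphB /= map_polyX map_polyC.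
  exact: map_char_poly.
apply: (fmorph_inj (real_complex R)); rewrite rmorph_sum /=.
transitivity (\sum_(z <- [seq a%:C%C | a <- eigenvalues B]) z ^+ k).
  by rewrite [RHS]big_map; apply: eq_bigr => a _; rewrite rmorphXn.
rewrite (perm_big _ pE) big_map big_enum /=.
have -> : (\tr (B ^+ k))%:C%C = \tr (BC ^+ k).
  rewrite -trace_map_mx; congr (\tr _); elim: {pE} k => [|k IH].
    by rewrite !expr0; exact: map_mx1.
  by rewrite !exprS -IH; exact: map_mxM.
have -> : BC ^+ k = invmx P *m diag_mx d ^+ k *m P.
  by rewrite {1}BE; exact: conjugate_exp.
rewrite (mxtrace_mulC _ P) mulmxA (mulmxV Pu) mul1mx diag_mx_exp.
by rewrite mxtrace_diag; apply: eq_bigr => i _; rewrite mxE.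
Qed.

Section SpectralMoment.
Variables (R : realType) (M : nat) (B : 'M[R]_M).
Local Notation nu := (spectral_distribution B).

Lemma ge0_integral_spectral (h : R -> R) : measurable_fun setT h ->
  (forall x, 0 <= h x) ->
  (\int[nu]_x (h x)%:E = (M%:R^-1 * \sum_(a <- eigenvalues B) h a)%:E)%E.
Proof.
move=> mh h0.
have mh' : @measurable_fun _ _ (measurableTypeR R) (\bar R) setT (EFin \o h).
  exact/measurable_EFinP.
have h0' (x : measurableTypeR R) : setT x -> (0 <= (EFin \o h) x)%E.
  by rewrite /= lee_fin.
rewrite /spectral_distribution.
etransitivity.
  exact: (@ge0_integral_mscale _ _ _ _ _ measurableT _ _ mh' h0').
rewrite EFinM; congr (_ * _)%E.
etransitivity.
  exact: (@ge0_integral_measure_sum _ _ _ _ _ measurableT _ h0' mh').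
rewrite -sumEFin (big_nth 0) big_mkord size_eigenvalues; apply: eq_bigr => i _.
etransitivity; first exact: (integral_dirac _ measurableT mh').
by rewrite diracT mul1e.
Qed.

Lemma moment_spectral k :
  moment nu k = M%:R^-1 * \sum_(a <- eigenvalues B) a ^+ k.
Proof.
rewrite /moment /Rintegral integralE.
have mX : measurable_fun setT (fun x : R => x ^+ k) by exact: measurable_funX.
rewrite [X in (X - _)%E](_ : _ = (\int[nu]_x (Num.max (x ^+ k) 0)%:E)%E); last first.
  by apply: eq_integral => x _; rewrite funeposE EFin_max.
rewrite [X in (_ - X)%E](_ : _ = (\int[nu]_x (Num.max (- x ^+ k) 0)%:E)%E); last first.
  by apply: eq_integral => x _; rewrite funenegE EFin_max.
rewrite !ge0_integral_spectral.
- rewrite /= -mulrBr -sumrB; congr (_ * _); apply: eq_bigr => a _.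
  by have [?|?] := leP 0 (a ^+ k); have [?|?] := leP 0 (- a ^+ k); lra.
- apply: measurable_maxr => //; exact: measurableT_comp.
- by move=> x; rewrite le_max lexx orbT.
- exact: measurable_maxr.
- by move=> x; rewrite le_max lexx orbT.
Qed.

End SpectralMoment.

(** * From a quadratic equation to a linear recurrence *)

Section QuadraticSeries.
Variables (R : realFieldType) (a : R) (c : nat -> R).
Hypotheses (c0 : c 0 = 1)
  (cS : forall m, c m.+1 = a * c m + \sum_(i < m.+1) c i * c (m - i)%N).

(** The generating series [t] solves the quadratic equation
    [z t^2 + (a z - 1) t + 1 = 0], so that [y = 2 z t + a z - 1] is a square root
    of the polynomial [D = (1 - a z)^2 - 4 z]. Differentiating [y^2 = D] gives
    the linear equation [2 D y' = D' y], whose coefficients are the recurrence.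
    The series are truncated to polynomials of size [n.+4], large enough for the
    coefficient of index [n.+2] to be unaffected. *)
Lemma quadratic_linear_rec n :
  (n + 3)%:R * c n.+2 = (2 * n + 3)%:R * (a + 2) * c n.+1 - n%:R * a ^+ 2 * c n.
Proof.
pose K := n.+4; pose P := \poly_(i < K) c i.
have PE i : (i < K)%N -> P`_i = c i by rewrite coef_poly => ->.
have natC m : (m%:R)%:P = m%:R :> {poly R} by exact: rmorph_nat.
pose E : {poly R} := 'X * P ^+ 2 + a%:P * ('X * P) - P + 1.
pose y : {poly R} := 2%:P * ('X * P) + a%:P * 'X - 1.
pose D : {poly R} := 1 - (2 * (a + 2))%:P * 'X + (a ^+ 2)%:P * 'X^2.
have E0 i : (i < K)%N -> E`_i = 0.
  move=> iK; rewrite !(coefB, coefD, coefCM, coefXM, coef1).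
  case: i iK => [_|i iK] /=; first by rewrite PE// c0; ring.
  rewrite !PE ?(ltnW iK)// cS expr2 coefM.
  have -> : \sum_(j < i.+1) P`_j * P`_(i - j) = \sum_(j < i.+1) c j * c (i - j)%N.
    apply: eq_bigr => j _; have := ltn_ord j; have := iK => *.
    by rewrite !PE//; lia.
  by ring.
have y2 : y ^+ 2 = D + 4%:P * ('X * E).
  by rewrite /y /E /D !natC rmorphXn polyCM natC polyCD natC /=; ring.
pose S := 'X * E.
have S0 i : (i <= K)%N -> S`_i = 0.
  by rewrite coefXM; case: i => // i iK; rewrite E0.
(* differentiating y ^ 2 = D modulo 'X^K gives 2 D y' = D' y *)
have ode : 2%:P * (D * y^`()) - D^`() * y =
    4%:P * (S^`() * y) - 8%:P * (S * y^`()).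
  have dy : 2%:P * (y * y^`()) = D^`() + 4%:P * S^`().
    have := congr1 (@deriv R) y2.
    rewrite expr2 derivM -/S derivD deriv_mulC => <-.
    by rewrite natC; ring.
  have y2' : D = y ^+ 2 - 4%:P * S by rewrite y2 addrK.
  transitivity (y * (2%:P * (y * y^`())) - 8%:P * (S * y^`()) - D^`() * y).
    by rewrite y2' !natC; ring.
  by rewrite dy !natC; ring.
have rem0 : (4%:P * (S^`() * y) - 8%:P * (S * y^`()))`_(n.+2) = 0.
  rewrite coefB !coefCM !coefM !big1 ?mulr0 ?subrr// => i _.
    by rewrite S0 ?mul0r// -/K; have := ltn_ord i; rewrite /K; lia.
  by rewrite coef_deriv S0 ?mul0rn ?mul0r//; have := ltn_ord i; rewrite /K; lia.
move: rem0; rewrite -ode => {ode}.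
have yE i : (i < K)%N -> y`_i.+1 = 2 * c i + a *+ (i == 0).
  move=> iK; rewrite !(coefB, coefD, coefCM, coefXM, coef1, coefX) /= PE//.
  by rewrite subr0 eqSS mulr_natr.
have DM q i : (D * q)`_i.+2 = q`_i.+2 - 2 * (a + 2) * q`_i.+1 + a ^+ 2 * q`_i.
  rewrite mulrDl mulrBl mul1r -!mulrA coefD coefB !coefCM coefXM /=.
  by rewrite !coefXM /=; ring.
have D'M q i : (D^`() * q)`_i.+1 = - (2 * (a + 2)) * q`_i.+1 + 2 * a ^+ 2 * q`_i.
  have -> : D^`() = - (2 * (a + 2))%:P + (2 * a ^+ 2)%:P * 'X.
    rewrite /D derivD derivB derivC !deriv_mulC derivX derivXn /= polyCM natC.
    by ring.
  by rewrite mulrDl -mulrA -polyCN coefD !coefCM coefXM.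
have dE (q : {poly R}) i : (q^`())`_i = i.+1%:R * q`_i.+1.
  by rewrite coef_deriv mulr_natl.
rewrite coefB coefCM DM D'M !dE !yE /K //; try lia.
rewrite /= !mulr0n !addr0; set z := a *+ _ => h.
have nz : n%:R * a ^+ 2 * z = 0.
  by rewrite /z; case: (n) => [|m]; rewrite ?mulr0n ?mulr0 ?mul0r.
have e3 : (n + 3)%:R = n%:R + 3 :> R by rewrite natrD.
have e23 : (2 * n + 3)%:R = 2 * n%:R + 3 :> R by rewrite natrD natrM.
have f3 : n.+3%:R = n%:R + 3 :> R by rewrite -e3 addn3.
have f2 : n.+2%:R = n%:R + 2 :> R by rewrite -natrD addn2.
have f1 : n.+1%:R = n%:R + 1 :> R by rewrite natr1.
by rewrite e3 e23; move: h; rewrite f3 f2 f1; lra.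
Qed.

End QuadraticSeries.

(** * Moments of the semicircle density *)

Section TrigIntegrals.
Local Open Scope classical_set_scope.
Variable R : realType.
Local Notation mu := (@lebesgue_measure R).

Lemma continuous_integrable_itv (f : R -> R) a b : continuous f ->
  mu.-integrable `[a, b] (EFin \o f).
Proof.
move=> cf; apply: continuous_compact_integrable; first exact: segment_compact.
exact: continuous_subspaceT.
Qed.

Lemma continuous_exp_comp (f : R -> R) k x : {for x, continuous f} ->
  {for x, continuous (fun t => f t ^+ k)}.
Proof.
by move=> cf; apply: (@continuous_comp _ _ _ f (fun y => y ^+ k)); [|exact: exprn_continuous].
Qed.

Lemma Rintegral_derive (F f : R -> R) (a b : R) : a < b -> continuous f ->
  (forall x : R, is_derive x 1 F (f x)) ->
  \int[mu]_(x in `[a, b]) f x = F b - F a.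
Proof.
move=> ab cf dF.
have dF' (x : R) : derivable F x 1 by have [] := dF x.
have cF : continuous F.
  by move=> x; apply: differentiable_continuous; exact/derivable1_diffP.
rewrite /Rintegral (@continuous_FTC2 _ f F)//.
- exact: continuous_subspaceT.
- split => //.
  + exact/cvg_at_right_filter/cF.
  + exact/cvg_at_left_filter/cF.
- by move=> x _; rewrite derive1E derive_val.
Qed.

Lemma Rintegral_lin2 (f g : R -> R) a b p q : continuous f -> continuous g ->
  \int[mu]_(x in `[a, b]) (p * f x + q * g x) =
  p * (\int[mu]_(x in `[a, b]) f x) + q * (\int[mu]_(x in `[a, b]) g x).
Proof.
move=> cf cg; rewrite RintegralD//.
- by rewrite !RintegralZl//; exact: continuous_integrable_itv.
- apply: continuous_integrable_itv => x; apply: cvgM; [exact: cvg_cst|exact: cf].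
- apply: continuous_integrable_itv => x; apply: cvgM; [exact: cvg_cst|exact: cg].
Qed.

Section Moments.
Variable s : R.
Hypothesis s_gt0 : 0 < s.

(** With [s] the square root of the parameter, [t] ranging from [0] to [pi] makes
    this point run backwards through the interval that supports the density of
    the Marchenko-Pastur law; it is the squared modulus of [1 + s * e^(i t)]. *)
Definition semicircle_pt (t : R) := 1 + s ^+ 2 + 2 * s * cos t.
Local Notation F := semicircle_pt.

Lemma is_derive_semicircle_pt (t : R) : is_derive t 1 F (- (2 * s * sin t)).
Proof.
rewrite /semicircle_pt; apply: is_derive_eq.
by rewrite /GRing.scale /=; ring.
Qed.

Lemma continuous_semicircle_pt : continuous F.
Proof.
move=> x; apply: cvgD; first exact: cvg_cst.
by apply: cvgM; [exact: cvg_cst|exact: continuous_cos].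
Qed.

Let g k t := F t ^+ k * sin t ^+ 2.

Lemma continuous_integrand k : continuous (g k).
Proof.
move=> x; apply: cvgM; apply: continuous_exp_comp.
  exact: continuous_semicircle_pt.
exact: continuous_sin.
Qed.

Definition trig_moment k := \int[mu]_(t in `[0, pi]) g k t.
Local Notation J := trig_moment.

Lemma trig_moment0 : J 0 = pi / 2.
Proof.
pose H (t : R) := (t - sin t * cos t) / 2.
have dH (x : R) : is_derive x 1 H (g 0 x).
  rewrite /H; apply: is_derive_eq.
  rewrite /g /GRing.scale /= expr0.
  by have := cos2Dsin2 x; lra.
rewrite /J (@Rintegral_derive H _ _ _ (pi_gt0 R) (@continuous_integrand 0) dH).
rewrite /H sinpi sin0 !mul0r !subr0; lra.
Qed.

(** The derivative of [F ^+ k * sin ^+ 3], which vanishes at both endpoints,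
    integrates to zero. *)
Lemma trig_moment_rec k : (k + 3)%:R * J k.+1 =
  (2 * k + 3)%:R * (1 + s ^+ 2) * J k - k%:R * (1 - s ^+ 2) ^+ 2 * J k.-1.
Proof.
pose H (t : R) := 2 * s * (F t ^+ k * sin t ^+ 3).
pose h (t : R) := (k + 3)%:R * g k.+1 t + 1 * (- (2 * k + 3)%:R * (1 + s ^+ 2) * g k t
   + k%:R * (1 - s ^+ 2) ^+ 2 * g k.-1 t).
have ch0 : continuous (fun t => - (2 * k + 3)%:R * (1 + s ^+ 2) * g k t
   + k%:R * (1 - s ^+ 2) ^+ 2 * g k.-1 t).
  by move=> x; apply: cvgD; apply: cvgM;
    first [exact: cvg_cst|exact: continuous_integrand].
have ch : continuous h.
  move=> x; apply: cvgD; (apply: cvgM; first exact: cvg_cst).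
    exact: continuous_integrand.
  exact: ch0.
have dH (x : R) : is_derive x 1 H (h x).
  have dF := is_derive_semicircle_pt x.
  have -> : H = (2 * s) \*: ((F ^+ k) * (sin ^+ 3)).
    by apply/funext => t; rewrite /H !exprfctE.
  apply: is_derive_eq.
  rewrite !exprfctE /GRing.scale /= /h /g [F x ^+ k.+1]exprSr natrD [(_ + 3)%:R]natrD natrM.
  have FK : k%:R * F x ^+ k - k%:R * F x ^+ k.-1 * F x = 0.
    by case: (k) => [|m]; rewrite ?mul0r ?subrr// exprSr mulrA subrr.
  have SC : sin x ^+ 2 - 1 + cos x ^+ 2 = 0 by have := cos2Dsin2 x; lra.
  apply/eqP; rewrite -subr_eq0; apply/eqP.
  (* the difference of both sides is a combination of [FK] and [SC] *)
  transitivity (sin x ^+ 2 * (2 * (1 + s ^+ 2) - F x) *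
      (k%:R * F x ^+ k - k%:R * F x ^+ k.-1 * F x) -
    4 * s ^+ 2 * k%:R * F x ^+ k.-1 * sin x ^+ 2 *
      (sin x ^+ 2 - 1 + cos x ^+ 2)); last by rewrite FK SC !mulr0 subrr.
  move: (F x ^+ k) (F x ^+ k.-1) => P Q; rewrite /semicircle_pt.
  by ring.
have := Rintegral_derive (pi_gt0 R) ch dH.
rewrite /H sinpi sin0 !expr0n !mulr0 subr0 /h.
rewrite (Rintegral_lin2 _ _ _ _ (@continuous_integrand _) ch0).
rewrite (Rintegral_lin2 _ _ _ _ (@continuous_integrand _) (@continuous_integrand _)).
rewrite -/(J k.+1) -/(J k) -/(J k.-1); lra.
Qed.

Let G k x := x ^+ k * Num.sqrt (4 * s ^+ 2 - (x - 1 - s ^+ 2) ^+ 2).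

Lemma continuous_semicircle k : continuous (G k).
Proof.
move=> x; apply: cvgM; first exact: exprn_continuous.
apply: continuous_comp; last exact: sqrt_continuous.
apply: cvgB; first exact: cvg_cst.
apply: (@continuous_exp_comp (fun x => x - 1 - s ^+ 2)).
apply: cvgB; last exact: cvg_cst.
by apply: cvgB; [exact: cvg_id|exact: cvg_cst].
Qed.

Lemma semicircle_pt0 : F 0 = (1 + s) ^+ 2.
Proof. by rewrite /semicircle_pt cos0; ring. Qed.

Lemma semicircle_ptpi : F pi = (1 - s) ^+ 2.
Proof. by rewrite /semicircle_pt cospi; ring. Qed.

(** Under the substitution [x = F t] the square root becomes [2 * s * sin t]. *)
Lemma integral_semicircle k :
  (\int[mu]_(x in `[((1 - s) ^+ 2)%R, ((1 + s) ^+ 2)%R]) (G k x)%:E =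
   (4 * s ^+ 2 * J k)%:E)%E.
Proof.
have F' : F^`() = fun t => - (2 * s * sin t).
  apply/funext => t; rewrite derive1E.
  by have [_ ->] := is_derive_semicircle_pt t.
have cF' : continuous (fun t : R => - (2 * s * sin t)).
  by move=> x; apply: cvgN; apply: cvgM; [exact: cvg_cst|exact: continuous_sin].
rewrite -semicircle_pt0 -semicircle_ptpi.
rewrite integration_by_substitution_decreasing ?pi_ge0//.
- rewrite F'; transitivity (\int[mu]_(t in `[0%R, pi]) (4 * s ^+ 2 * g k t)%:E)%E.
    apply: eq_integral => t; rewrite inE /= in_itv /= => tpi; congr EFin.
    rewrite /G /g opprK !fctE /=.
    have -> : 4 * s ^+ 2 - (F t - 1 - s ^+ 2) ^+ 2 = (2 * s * sin t) ^+ 2.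
      have := cos2Dsin2 t; rewrite /semicircle_pt => e.
      transitivity (4 * s ^+ 2 * (1 - cos t ^+ 2)); first by ring.
      by rewrite (_ : 1 - cos t ^+ 2 = sin t ^+ 2); [ring|lra].
    rewrite sqrtr_sqr ger0_norm; first by move: (F t ^+ k) => P; ring.
    by rewrite !mulr_ge0 ?sin_ge0_pi// ltW.
  rewrite /J -RintegralZl//; last exact/continuous_integrable_itv/continuous_integrand.
  rewrite /Rintegral fineK//; apply: integrable_fin_num => //.
  apply: continuous_integrable_itv => x; apply: cvgM; first exact: cvg_cst.
  exact: continuous_integrand.
- move=> x y xI yI xy; rewrite /semicircle_pt ltrD2l ltr_pM2l ?mulr_gt0//.
  by rewrite ltr_cos.
- by move=> x _; rewrite F'; exact: cF'.
- by rewrite F'; apply/cvg_ex; exists (- (2 * s * sin 0)); exact/cvg_at_right_filter/cF'.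
- by rewrite F'; apply/cvg_ex; exists (- (2 * s * sin pi)); exact/cvg_at_left_filter/cF'.
- split=> [x _||].
  + by have [] := is_derive_semicircle_pt x.
  + exact/cvg_at_right_filter/continuous_semicircle_pt.
  + exact/cvg_at_left_filter/continuous_semicircle_pt.
- exact/continuous_subspaceT/continuous_semicircle.
Qed.

End Moments.
End TrigIntegrals.

(** * Integration against a measure with a density *)

Section Density.
Local Open Scope classical_set_scope.
Local Open Scope ereal_scope.
Context d (T : measurableType d) (R : realType).
Variables (mu m : {measure set T -> \bar R}) (g : T -> R).
Hypotheses (mg : measurable_fun [set: T] g) (g0 : forall x, (0 <= g x)%R).
Hypothesis mE : forall V, measurable V -> m V = \int[mu]_(x in V) (g x)%:E.

Let mg' : measurable_fun [set: T] (EFin \o g).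
Proof. exact/measurable_EFinP. Qed.

Let integral_density_indic V : measurable V ->
  \int[m]_x (\1_V x)%:E = \int[mu]_x ((\1_V x)%:E * (g x)%:E).
Proof.
move=> mV; rewrite integral_indic// setIT mE// integral_mkcond.
apply: eq_integral => x _; rewrite patchE indicE.
by case: ifPn => xV; rewrite ?mul1e ?mul0e.
Qed.

Import HBNNSimple.

Let integral_density_nnsfun (f : {nnsfun T >-> R}) :
  \int[m]_x (f x)%:E = \int[mu]_x ((f x)%:E * (g x)%:E).
Proof.
under [LHS]eq_integral do rewrite fimfunE -fsumEFin//.
rewrite [LHS]ge0_integral_fsum//; last 2 first.
  - by move=> r; exact/measurable_EFinP/measurableT_comp.
  - by move=> n x _; rewrite EFinM nnfun_muleindic_ge0.
under [RHS]eq_integral.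
  move=> x xD; rewrite fimfunE -fsumEFin// ge0_mule_fsuml; last first.
    by move=> r; rewrite EFinM nnfun_muleindic_ge0.
  over.
rewrite [RHS]ge0_integral_fsum//; last 2 first.
  - move=> r; apply: emeasurable_funM => //.
    by apply/measurable_EFinP; do 2 apply/measurableT_comp => //.
  - move=> n x _; rewrite EFinM mule_ge0//; last by rewrite lee_fin.
    by rewrite nnfun_muleindic_ge0.
apply: eq_fsbigr => r /[!inE] -[x _ <-].
under [RHS]eq_integral do rewrite EFinM -muleA.
rewrite [RHS]ge0_integralZl//.
- by rewrite !integralZl_indic_nnsfun//= integral_density_indic.
- apply: emeasurable_funM => //; exact/measurable_EFinP/measurable_indic.
- by move=> y _; rewrite mule_ge0// lee_fin// indicE.
- by rewrite lee_fin.
Qed.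

(** Monotone convergence extends the identity from indicators, where it is the
    definition of the density. *)
Lemma ge0_integral_density (f : T -> \bar R) :
  measurable_fun setT f -> (forall x, 0 <= f x) ->
  \int[m]_x f x = \int[mu]_x (f x * (g x)%:E).
Proof.
move=> mf f0; pose f_ := nnsfun_approx measurableT mf.
transitivity (lim (\int[m]_x (f_ n x)%:E @[n --> \oo])).
  rewrite -monotone_convergence//=.
  - apply: eq_integral => x _; apply/esym/cvg_lim => //=.
    exact: cvg_nnsfun_approx.
  - by move=> n; exact/measurable_EFinP/measurable_funTS.
  - by move=> n x _; rewrite lee_fin.
  - by move=> x _ a b ab; rewrite lee_fin; exact/lefP/nd_nnsfun_approx.
rewrite [RHS](_ : _ = lim (\int[mu]_x ((f_ n x)%:E * (g x)%:E) @[n --> \oo])).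
  by apply: congr_lim; apply/funext => n /=; exact: integral_density_nnsfun.
rewrite -monotone_convergence//=.
- apply: eq_integral => x _; apply/esym/cvg_lim => //.
  by apply: cvgeZr => //; exact: cvg_nnsfun_approx.
- move=> n; apply: emeasurable_funM => //.
  exact/measurable_EFinP/measurable_funTS.
- by move=> n x _; rewrite mule_ge0// lee_fin.
- move=> x _ a b ab; apply: lee_wpmul2r; first by rewrite lee_fin.
  by rewrite lee_fin; exact/lefP/nd_nnsfun_approx.
Qed.

End Density.

(** * Moments of the Marchenko-Pastur law *)

Section MPMoments.
Local Open Scope classical_set_scope.
Variables (R : realType) (s : R).
Hypothesis s_gt0 : 0 < s.
Local Notation lam := (s ^+ 2).
Local Notation mu := (@lebesgue_measure R).

Definition mp_moment k : R := 4 * s ^+ 2 * trig_moment s k / (2 * pi).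

Lemma ge0_integral_MP (h : R -> R) : measurable_fun setT h -> (forall x, 0 <= h x) ->
  (\int[marchenko_pastur lam]_x (h x)%:E =
   (Num.max (1 - lam) 0 * h 0)%:E + \int[mu]_x (h x * MP_density lam x)%:E)%E.
Proof.
move=> mh h0.
have mh' : @measurable_fun _ _ (measurableTypeR R) (\bar R) setT (EFin \o h).
  exact/measurable_EFinP.
have h0' (x : measurableTypeR R) : setT x -> (0 <= (EFin \o h) x)%E.
  by rewrite /= lee_fin.
rewrite /marchenko_pastur; etransitivity.
  exact: (ge0_integral_measure_add _ _ measurableT h0' mh').
congr (_ + _)%E.
  etransitivity; first exact: (@ge0_integral_mscale _ _ _ _ _ measurableT _ _ mh' h0').
  rewrite EFinM; congr (_ * _)%E.
  etransitivity; first exact: (integral_dirac _ measurableT mh').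
  by rewrite diracT mul1e.
under [RHS]eq_integral do rewrite EFinM.
apply: (@ge0_integral_density _ (measurableTypeR R) R lebesgue_measure
  (MP_ac lam) _ (@measurable_MP_density R lam)) => //.
exact: MP_density_ge0.
Qed.

(** One factor [x] of the integrand cancels the denominator of the density; at
    the boundary case [x = 0] of the support both sides vanish. *)
Lemma integral_MP_density k (h : R -> R) :
  (forall x, 0 <= x -> h x = x ^+ k.+1) ->
  (\int[mu]_x (h x * MP_density lam x)%:E = (mp_moment k)%:E)%E.
Proof.
move=> hE.
pose G x := x ^+ k * Num.sqrt (4 * s ^+ 2 - (x - 1 - s ^+ 2) ^+ 2).
transitivity (\int[mu]_(x in `[((1 - s) ^+ 2)%R, ((1 + s) ^+ 2)%R])
    ((2 * pi)^-1 * G x)%:E)%E.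
  rewrite [RHS]integral_mkcond; apply: eq_integral => x _.
  rewrite patchE /MP_density sqrtr_sqr (gtr0_norm s_gt0) mem_setE in_itv /=.
  case: ifPn => [/andP[ax xb]|_]; last by rewrite mulr0.
  have x0 : 0 <= x by exact: le_trans (sqr_ge0 _) ax.
  congr EFin; rewrite hE// /G; have [->|xn0] := eqVneq x 0; last first.
    have : pi != 0 :> R by rewrite gt_eqF ?pi_gt0.
    by rewrite exprS; move: (pi : R) => p p0; field; rewrite xn0 p0.
  rewrite expr0n mul0r ler0_sqrtr ?mulr0//.
  have -> : 4 * s ^+ 2 - (0 - 1 - s ^+ 2) ^+ 2 = - (1 - s ^+ 2) ^+ 2 by ring.
  by rewrite oppr_le0 sqr_ge0.
have iG : mu.-integrable `[((1 - s) ^+ 2)%R, ((1 + s) ^+ 2)%R] (EFin \o G).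
  by apply: continuous_integrable_itv; exact: continuous_semicircle.
under eq_integral do rewrite EFinM.
rewrite integralZl// integral_semicircle// -EFinM; congr EFin.
by rewrite /mp_moment mulrC.
Qed.

Let measurable_power n : measurable_fun setT (fun x : R => x ^+ n).
Proof. exact: measurable_funX. Qed.

Lemma all_moments_MP : all_moments (marchenko_pastur lam).
Proof.
case=> // n _; apply/integrableP; split.
  exact/measurable_EFinP/measurable_funX.
under eq_integral do rewrite abse_EFin.
rewrite ge0_integral_MP//; last exact: measurableT_comp.
rewrite (@integral_MP_density n); first by rewrite -EFinD ltry.
by move=> x x0; rewrite ger0_norm// exprn_ge0.
Qed.

(** The negative part of [x ^+ k.+1] lives on the negative half-line, which the
    law does not charge, and the positive order removes the atom at [0]. *)
Lemma moment_MP k : moment (marchenko_pastur lam) k.+1 = mp_moment k.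
Proof.
rewrite /moment /Rintegral integralE.
rewrite [X in (X - _)%E](_ : _ =
    (\int[marchenko_pastur lam]_x (Num.max (x ^+ k.+1) 0)%:E)%E); last first.
  by apply: eq_integral => x _; rewrite funeposE EFin_max.
rewrite [X in (_ - X)%E](_ : _ =
    (\int[marchenko_pastur lam]_x (Num.max (- x ^+ k.+1) 0)%:E)%E); last first.
  by apply: eq_integral => x _; rewrite funenegE EFin_max.
rewrite !ge0_integral_MP.
- rewrite (@integral_MP_density k); last first.
    by move=> x x0; apply/max_idPl; rewrite exprn_ge0.
  rewrite integral0_eq => [|x _].
    by rewrite !exprS !mul0r oppr0 maxxx mulr0 !adde0 add0e sube0.
  congr EFin; have [x0|x0] := leP 0 x.
    by rewrite (max_idPr _) ?mul0r// oppr_le0 exprn_ge0.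
  rewrite /MP_density; case: ifP => [/andP[ax _]|_]; last by rewrite mulr0.
  by have := le_lt_trans ax x0; rewrite ltNge sqr_ge0.
- apply: measurable_maxr => //; exact: measurableT_comp.
- by move=> x; rewrite le_max lexx orbT.
- exact: measurable_maxr.
- by move=> x; rewrite le_max lexx orbT.
Qed.

Lemma mp_moment0 : mp_moment 0 = lam.
Proof.
rewrite /mp_moment trig_moment0.
have : pi != 0 :> R by rewrite gt_eqF ?pi_gt0.
by move: (pi : R) => p p0; field.
Qed.

Lemma mp_moment_rec k : (k + 3)%:R * mp_moment k.+1 =
  (2 * k + 3)%:R * (1 + lam) * mp_moment k - k%:R * (1 - lam) ^+ 2 * mp_moment k.-1.
Proof.
rewrite /mp_moment; have := trig_moment_rec s k.
set u := (k + 3)%:R; set v := (2 * k + 3)%:R => e.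
transitivity (4 * s ^+ 2 / (2 * pi) * (u * trig_moment s k.+1)); first by ring.
by rewrite e; ring.
Qed.

(** The quadratic recursion determines its solution, and by [quadratic_linear_rec]
    that solution obeys the linear recurrence of the integrals, with [a = lam - 1]
    and the index shifted by one. *)
Lemma quadratic_mp_moment (c : nat -> R) : c 0 = 1 ->
  (forall m, c m.+1 = (lam - 1) * c m + \sum_(i < m.+1) c i * c (m - i)%N) ->
  forall k, c k.+1 = mp_moment k.
Proof.
move=> c0 cS; elim/ltn_ind => -[_|k IH].
  by rewrite mp_moment0 cS big_ord1 subnn c0; ring.
have k3 : (k + 3)%:R != 0 :> R by rewrite pnatr_eq0 addn3.
apply: (mulfI k3); rewrite mp_moment_rec (quadratic_linear_rec c0 cS) IH//.
congr (_ - _); first by congr (_ * _); congr (_ * _); ring.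
case: k IH {k3} => [|k] IH; first by rewrite !mul0r.
by rewrite IH// /=; congr (_ * _); congr (_ * _); ring.
Qed.

End MPMoments.

(** For [B = 1] all the cumulants are equal, hence the shift of the first block
    is immaterial and the system of recursions reduces to a single one. *)
Lemma wishart_moment_quadratic (R : fieldType) (M N : nat) (m : nat) :
  (N%:R : R) != 0 ->
  let c := wishart_moment N (1%:M : 'M[R]_M.+1) in
  c m.+1 = (M.+1%:R / N%:R - 1) * c m + \sum_(i < m.+1) c i * c (m - i)%N.
Proof.
move=> N0 c.
have B1 k : (1%:M : 'M[R]_M.+1) ^+ k = 1%:M by exact: expr1n.
rewrite big_ord_recr /= subnn /c wishart_moment0// mulr1.
rewrite wishart_momentS//; last exact: trmx1.
rewrite (wishart_shifted_rec _ N0) /wishart_cumulant B1 mxtrace1.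
have -> : \sum_(i < m) c i *
    shifted_moment N (1%:M : 'M[R]_M.+1) 1 (m - i) =
    \sum_(i < m) c i * c (m - i)%N.
  apply: eq_bigr => i _; congr (_ * _).
  have : (0 < m - i)%N by rewrite subn_gt0.
  case: (m - i)%N => // n _; rewrite /c wishart_momentS//; last exact: trmx1.
  by rewrite /shifted_moment; apply: eq_bigr => j _; rewrite !B1.
by rewrite /c; ring.
Qed.

(** * The law of a free Wishart matrix *)

Theorem proposition2p19 (R : realType) (A : ncProbSpace R) (M N : nat)
    (M_gt0 : (0 < M)%N) (N_gt0 : (0 < N)%N) :
  let lam : R := M%:R / N%:R in
  (forall (B : 'M[R]_M) (W : 'M[A]_N),
     posdefmx B -> qWishart 0 1%:M B W ->
     let nu := spectral_distribution B in
     has_moments (scalemx_nc N%:R^-1 W) (compound_MP_moment nu lam) /\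
     forall mu : probability (measurableTypeR R) R,
       is_compound_MP nu lam mu -> has_law (scalemx_nc N%:R^-1 W) mu) /\
  (forall W : 'M[A]_N,
     qWishart 0 1%:M (1%:M : 'M[R]_M) W ->
     has_law (scalemx_nc N%:R^-1 W) (marchenko_pastur lam)).
Proof.
move=> lam; case: M M_gt0 @lam => // M _ lam.
have N0 : (N%:R : R) != 0 by rewrite pnatr_eq0 -lt0n.
split=> [B W [BT _] wW nu|W wW].
  have [selfadj momW] := wishart_has_moments wW.
  have momE n : compound_MP_moment nu lam n = wishart_moment N B n.
    rewrite -compound_MP_momentE; apply: wishart_moment_cumulants => // k _.
    rewrite /compound_MP_cumulant moment_spectral sum_eigenvalues_exp//.
    rewrite /wishart_cumulant mulrA /lam [_ / _ / _]mulrAC divff ?mul1r//.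
  have mW : has_moments (scalemx_nc N%:R^-1 W) (compound_MP_moment nu lam).
    by split=> // n n0; rewrite momW// momE.
  split=> // mu [mu_int muE]; split=> //; split=> // n n0.
  by have [_ ->] := mW; rewrite // muE// compound_MP_momentE.
have [selfadj momW] := wishart_has_moments wW.
have lam_gt0 : 0 < lam by rewrite divr_gt0 ?ltr0n.
have lamE : Num.sqrt lam ^+ 2 = lam by rewrite sqr_sqrtr// ltW.
have s_gt0 : 0 < Num.sqrt lam by rewrite sqrtr_gt0.
split; first by rewrite -lamE; exact: all_moments_MP.
split=> // -[//|k] _; rewrite momW//; congr (_ %:C)%C.
rewrite -lamE moment_MP//.
apply: (quadratic_mp_moment (c := wishart_moment N (1%:M : 'M[R]_M.+1))).
  exact: wishart_moment0.
by move=> m; rewrite lamE; exact: wishart_moment_quadratic.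
Qed.
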